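(* Let $n\ge m$, let $a=(a_0,\dots,a_{n-1})$ be an arbitrary sequence, and let $b_i=f(i)$ for $i\in\{0,\dots,m-1\}$, where $f$ is a polynomial with integer coefficients of degree at most $d$ (for a fixed $d$). Then the sequence $c_k=\min_{0\le i\le m-1}\{a_{k+i}+b_i\}$, $k\in\{0,\dots,n-m\}$, can be computed by an algorithm with arithmetic complexity $$O\bigl(d^3\cdot n^{1+\frac{\sigma-1}{\sigma}}\cdot\log^2(n)\bigr),\qquad\text{where }\sigma=\log_2(d)+\frac{1}{1+\log_2(d)}.$$
   Context: Complexity is measured as the number of elementary arithmetic operations. *)

(* Defs.v *)
From HB Require Import structures.
From mathcomp Require Import all_boot all_order all_algebra.
From mathcomp Require Import reals exp.

Set Implicit Arguments.
Unset Strict Implicit.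
Unset Printing Implicit Defensive.

Import Order.TTheory GRing.Theory Num.Theory.
Local Open Scope ring_scope.

(* Algorithms are programs for a unit-cost random access machine with two kinds
   of cells: data cells, holding elements of an ordered field on which only the
   four operations and comparisons are available (no rounding), and index
   cells, holding natural numbers used for counters and addresses.  Each kind
   has registers, named in the program text, and a memory, addressed by index
   registers only.  Index registers have no multiplication and no conversion
   from data, so unit-cost arithmetic on huge integers cannot be exploited.
   Programs contain no field constants. *)
Inductive instr : Type :=
  | IConst (x c : nat)
  | IAdd (x y z : nat)
  | ISub (x y z : nat)    (* truncated *)
  | IHalf (x y : nat)     (* rounded down *)
  | ILoad (x p : nat)     (* x := mem[p] *)
  | IStore (p x : nat)    (* mem[p] := x *)
  | DOfIndex (x y : nat)  (* data register x := index register y *)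
  | DAdd (x y z : nat)
  | DSub (x y z : nat)
  | DMul (x y z : nat)
  | DDiv (x y z : nat)    (* x / 0 = 0, as in any fieldType *)
  | DLoad (x p : nat)     (* p is an index register *)
  | DStore (p x : nat).

Inductive test : Type :=
  | ILe (x y : nat)
  | DLe (x y : nat).

Inductive cmd : Type :=
  | Skip
  | Do (i : instr)
  | Seq (p q : cmd)
  | If (b : test) (p q : cmd)
  | While (b : test) (p : cmd).

Record state (R : Type) : Type := State {
  ireg : nat -> nat;
  imem : nat -> nat;
  dreg : nat -> R;
  dmem : nat -> R
}.

Definition set_ireg (R : Type) (s : state R) (x v : nat) : state R :=
  State [eta ireg s with x |-> v] (imem s) (dreg s) (dmem s).

Definition set_imem (R : Type) (s : state R) (x v : nat) : state R :=
  State (ireg s) [eta imem s with x |-> v] (dreg s) (dmem s).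

Definition set_dreg (R : Type) (s : state R) (x : nat) (v : R) : state R :=
  State (ireg s) (imem s) [eta dreg s with x |-> v] (dmem s).

Definition set_dmem (R : Type) (s : state R) (x : nat) (v : R) : state R :=
  State (ireg s) (imem s) (dreg s) [eta dmem s with x |-> v].

Definition step (R : realFieldType) (i : instr) (s : state R) : state R :=
  match i with
  | IConst x c => set_ireg s x c
  | IAdd x y z => set_ireg s x (ireg s y + ireg s z)%N
  | ISub x y z => set_ireg s x (ireg s y - ireg s z)%N
  | IHalf x y => set_ireg s x (ireg s y)./2
  | ILoad x p => set_ireg s x (imem s (ireg s p))
  | IStore p x => set_imem s (ireg s p) (ireg s x)
  | DOfIndex x y => set_dreg s x (ireg s y)%:R
  | DAdd x y z => set_dreg s x (dreg s y + dreg s z)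
  | DSub x y z => set_dreg s x (dreg s y - dreg s z)
  | DMul x y z => set_dreg s x (dreg s y * dreg s z)
  | DDiv x y z => set_dreg s x (dreg s y / dreg s z)
  | DLoad x p => set_dreg s x (dmem s (ireg s p))
  | DStore p x => set_dmem s (ireg s p) (dreg s x)
  end.

Definition eval_test (R : realFieldType) (b : test) (s : state R) : bool :=
  match b with
  | ILe x y => (ireg s x <= ireg s y)%N
  | DLe x y => dreg s x <= dreg s y
  end.

(* [exec p s t s']: started in state s, program p halts in state s' after t
   operations; every instruction and every evaluation of a test counts 1, so t
   bounds the number of arithmetic operations and comparisons performed. *)
Inductive exec (R : realFieldType) : cmd -> state R -> nat -> state R -> Prop :=
  | exec_skip s : exec Skip s 0 s
  | exec_do i s : exec (Do i) s 1 (step i s)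
  | exec_seq p q s1 s2 s3 t1 t2 :
      exec p s1 t1 s2 -> exec q s2 t2 s3 -> exec (Seq p q) s1 (t1 + t2)%N s3
  | exec_if_true b p q s1 s2 t :
      eval_test b s1 -> exec p s1 t s2 -> exec (If b p q) s1 t.+1 s2
  | exec_if_false b p q s1 s2 t :
      ~~ eval_test b s1 -> exec q s1 t s2 -> exec (If b p q) s1 t.+1 s2
  | exec_while_true b p s1 s2 s3 t1 t2 :
      eval_test b s1 -> exec p s1 t1 s2 -> exec (While b p) s2 t2 s3 ->
      exec (While b p) s1 (t1 + t2).+1 s3
  | exec_while_false b p s :
      ~~ eval_test b s -> exec (While b p) s 1 s.

(* Index registers 0, 1, 2 hold n, m, d; the data memory holds a_0 .. a_(n-1)
   followed by the d + 1 coefficients f_0 .. f_d; all other cells hold 0. *)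
Definition init_state (R : realFieldType) (n m d : nat) (a : n.-tuple R)
    (f : {poly int}) : state R :=
  State (nth 0%N [:: n; m; d]) (fun=> 0%N) (fun=> 0)
        (nth 0 (a ++ [seq (f`_i)%:~R | i <- iota 0 d.+1])).

(* The seed of the iterated minimum is its term of index 0, so this is the
   minimum over 0 <= i <= m - 1 as soon as m > 0. *)
Definition window_min (R : realFieldType) (a b : nat -> R) (m k : nat) : R :=
  \big[Num.min/a k + b 0%N]_(0 <= i < m) (a (k + i)%N + b i).

Definition log2 (R : realType) (x : R) : R := ln x / ln 2.

Definition sigma (R : realType) (d : nat) : R :=
  log2 d%:R + 1 / (1 + log2 d%:R).

(* Main.v *)
Require Import Defs.
From mathcomp Require Import all_boot all_order all_algebra.
From mathcomp Require Import boolp reals exp.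
From mathcomp Require Import zify lra.

Import Order.TTheory GRing.Theory Num.Theory.
Local Open Scope ring_scope.
Set Implicit Arguments.
Unset Strict Implicit.
Unset Printing Implicit Defensive.

(* Arrange the candidates a_j + b_(j - k) in a matrix with rows k and columns j.
   Call a dyadic square of side L at offset D = delta L from the main diagonal
   good if the differences j - k met in it, which fill the open interval
   (D - L, D + L), are legal indices of b and the second difference of b keeps
   its sign there.  On a good square the matrix, or its mirror image, is Monge,
   so the columns of the row minima are monotone, and O(L log L) operations find
   them by halving the distance between the rows already known.

   The maximal good squares cover all candidates, and if a good square is
   maximal, the wider interval (D - 3L, D + 3L) is not good.  The second
   difference of b is a polynomial of degree at most d, so by the intermediate
   value theorem only O(d) of the offsets of a given side are good without being
   good in this wider sense.  Treating exactly those offsets costs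
   O(d n log^2 n), which is enough because sigma >= 1. *)

(** * Program logic *)

Definition block (l : seq instr) : cmd := foldr (fun i => Seq (Do i)) Skip l.

Definition iwrites_instr (i : instr) (x : nat) : bool :=
  match i with
  | IConst y _ | IAdd y _ _ | ISub y _ _ | IHalf y _ | ILoad y _ => x == y
  | _ => false
  end.

Definition dwrites_instr (i : instr) (x : nat) : bool :=
  match i with
  | DOfIndex y _ | DAdd y _ _ | DSub y _ _ | DMul y _ _ | DDiv y _ _
  | DLoad y _ => x == y
  | _ => false
  end.

Definition is_istore (i : instr) := if i is IStore _ _ then true else false.
Definition is_dstore (i : instr) := if i is DStore _ _ then true else false.

Arguments block l : simpl never.

Fixpoint occurs (w : instr -> bool) (c : cmd) : bool :=
  match c with
  | Skip => false
  | Do i => w i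
  | Seq p q | If _ p q => occurs w p || occurs w q
  | While _ p => occurs w p
  end.

Section Logic.
Variable R : realFieldType.
Implicit Types (s : state R) (c : cmd) (Q : nat -> state R -> Prop).

(** What a command may change is read off its text, so for a concrete program the side conditions
    compute and [isT] proves them. *)
Definition frame c s s' : Prop :=
  [/\ forall x, ~~ occurs (iwrites_instr^~ x) c -> ireg s' x = ireg s x,
      forall x, ~~ occurs (dwrites_instr^~ x) c -> dreg s' x = dreg s x,
      ~~ occurs is_istore c -> imem s' = imem s &
      ~~ occurs is_dstore c -> dmem s' = dmem s].

Lemma frame_refl c s : frame c s s.
Proof. by []. Qed.

Lemma frame_trans c s1 s2 s3 : frame c s1 s2 -> frame c s2 s3 -> frame c s1 s3.
Proof.
move=> [i1 d1 m1 n1] [i2 d2 m2 n2]; split=> [x nx|x nx|nx|nx].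
- by rewrite i2 // i1.
- by rewrite d2 // d1.
- by rewrite m2 // m1.
- by rewrite n2 // n1.
Qed.

Lemma frame_sub c c' s s' :
  (forall w, occurs w c -> occurs w c') -> frame c s s' -> frame c' s s'.
Proof.
move=> sub [i1 d1 m1 n1]; split=> [x|x||] /(contra (sub _)).
- exact: i1.
- exact: d1.
- exact: m1.
- exact: n1.
Qed.

Lemma exec_frame c s t s' : exec c s t s' -> frame c s s'.
Proof.
elim=> {c s t s'} [s|i s|p q s1 s2 s3 t1 t2 _ f1 _ f2|b p q s1 s2 t _ _ f1
  |b p q s1 s2 t _ _ f1|b p s1 s2 s3 t1 t2 _ _ f1 _ f2|b p s _]; try by [].
- by case: i => *; split=> //= x /negbTE ->.
- by apply: frame_trans (frame_sub _ f1) (frame_sub _ f2) => w /= ->;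
    rewrite ?orbT.
- by apply: frame_sub f1 => w /= ->.
- by apply: frame_sub f1 => w /= ->; rewrite orbT.
- exact: frame_trans f1 f2.
Qed.

(** Total correctness with cost: termination is part of the claim and postconditions see the time,
    so a program can be executed symbolically from front to back. *)
Definition runs c s Q : Prop := exists t s', exec c s t s' /\ Q t s'.

Lemma runs_frame c s Q :
  runs c s (fun t s' => frame c s s' -> Q t s') -> runs c s Q.
Proof. by move=> [t [s' [ex q]]]; exists t, s'; split=> //; apply/q/exec_frame/ex. Qed.

Lemma runs_conseq c s Q Q' :
  runs c s Q -> (forall t s', frame c s s' -> Q t s' -> Q' t s') -> runs c s Q'.
Proof.
move=> [t [s' [ex q]]] qq; exists t, s'; split=> //.
by apply: qq => //; apply: exec_frame ex.
Qed.

Lemma runs_seq c1 c2 s Q :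
  runs c1 s (fun t1 s1 => runs c2 s1 (fun t2 s2 => Q (t1 + t2)%N s2)) ->
  runs (Seq c1 c2) s Q.
Proof.
move=> [t1 [s1 [e1 [t2 [s2 [e2 q]]]]]]; exists (t1 + t2)%N, s2; split=> //.
exact: exec_seq e1 e2.
Qed.

Lemma runs_if b c1 c2 s Q :
  (eval_test b s -> runs c1 s (fun t => Q t.+1)) ->
  (~~ eval_test b s -> runs c2 s (fun t => Q t.+1)) ->
  runs (If b c1 c2) s Q.
Proof.
move=> h1 h2; case: (boolP (eval_test b s)) => hb.
  by have [t [s' [ex q]]] := h1 hb; exists t.+1, s'; split=> //; apply: exec_if_true.
by have [t [s' [ex q]]] := h2 hb; exists t.+1, s'; split=> //; apply: exec_if_false.
Qed.

Lemma runs_skip s Q : Q 0%N s -> runs Skip s Q.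
Proof. by move=> q; exists 0%N, s; split=> //; apply: exec_skip. Qed.

Lemma runs_do i s Q : Q 1%N (step i s) -> runs (Do i) s Q.
Proof. by move=> q; exists 1%N, (step i s); split=> //; apply: exec_do. Qed.

Lemma runs_block l s Q :
  Q (size l) (foldl (fun s i => step i s) s l) -> runs (block l) s Q.
Proof.
elim: l s Q => [|i l IHl] s Q /=; first exact: runs_skip.
by move=> q; apply/runs_seq/runs_do/IHl; rewrite add1n.
Qed.

(* The invariant is indexed by the number of completed iterations and by the
   time they took. *)
Lemma runs_while b c s0 (N : nat) (I : nat -> nat -> state R -> Prop) Q :
  I 0%N 0%N s0 ->
  (forall i tau s, (i < N)%N -> frame c s0 s -> I i tau s ->
     eval_test b s /\ runs c s (fun t s' => frame c s0 s' -> I i.+1 (tau + t).+1 s')) ->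
  (forall tau s, frame c s0 s -> I N tau s -> ~~ eval_test b s /\ Q tau.+1 s) ->
  runs (While b c) s0 Q.
Proof.
move=> I0 body stop.
(* Induction on the number [k] of iterations still to come. *)
suff loop k : (k <= N)%N -> forall tau s, frame c s0 s -> I (N - k)%N tau s ->
    runs (While b c) s (fun t s' => Q (tau + t)%N s').
  by apply: (loop N (leqnn N) 0%N s0 (frame_refl _ _)); rewrite subnn.
elim: k => [_|k IHk kN] tau s fs Is.
  rewrite subn0 in Is; have [nb q] := stop _ _ fs Is.
  by exists 1%N, s; rewrite addn1; split=> //; apply: exec_while_false.
have lt : (N - k.+1 < N)%N by lia.
have [hb [t [s' [ex]]]] := body _ _ _ lt fs Is.
have fs' : frame c s0 s' by apply: frame_trans fs (exec_frame ex).
move=> /(_ fs'); rewrite subnSK // => Is'.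
have [t' [s'' [ex' q]]] := IHk (ltnW kN) _ _ fs' Is'.
exists (t + t').+1, s''; split; first exact: exec_while_true ex ex'.
by rewrite addnS addnA.
Qed.

End Logic.

(** * The program *)

(* Index registers: 0, 1, 2 are n, m, d; 3 is the constant 1; 4 and 5 are the
   addresses B of b_0 and C of the candidate for c_0; 6 and 7 are n - 1 and
   m - 1; 8, 9, 10 serve the initial and final passes; 11 is the side L, 12 is
   D + L, 13 is the offset D, 22 is 3L, 27 is L - 1; 14 and 15 delimit a range
   of indices of b, 16 and 17 tell whether b is convex or concave on it, 18 and
   19 are scratch, 20 tells whether the range is good; 23 is the end of the
   columns of a square, 24 and 26 its first and last column, 25 its first row;
   28 is the row stride H and 36 is 2H; 29 is a row of the square, 32 the same
   row in the matrix, 30 and 31 bound its columns, 33 is the current column, 34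
   the best one; 35 is an address.  Data register 9 stays 0.  Cell r of the
   index memory holds the best column found for row r of the current square. *)
Definition copy (x y : nat) : seq instr := [:: IConst x 0; IAdd x x y].

(** On a range that is only concave, register 33 counts columns from the right; this mirror image is
    what makes the matrix Monge. *)
Definition entry_prog : cmd :=
  Seq (If (ILe 3 16) (Do (IAdd 35 24 33)) (Do (ISub 35 26 33)))
      (block [:: DLoad 0 35; ISub 35 35 32; IAdd 35 4 35; DLoad 2 35; DAdd 0 0 2]).

Definition scan_loop : cmd :=
  While (ILe 33 31)
    (Seq entry_prog
    (Seq (If (DLe 1 0) Skip (block (DAdd 1 0 9 :: copy 34 33)))
         (Do (IAdd 33 33 3)))).

(** The first column of the range seeds the minimum and is visited once more by the loop. *)
Definition scan_prog : cmd :=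
  Seq (block (IAdd 32 25 29 :: copy 33 30))
  (Seq entry_prog
  (Seq (block (DAdd 1 0 9 :: copy 34 33))
  (Seq scan_loop
  (Seq (block [:: IStore 29 34; IAdd 35 5 32; DLoad 2 35])
       (If (DLe 2 1) Skip (Do (DStore 35 1))))))).

(** An odd multiple of H lies between two rows already solved, and their best columns bound its
    search. *)
Definition row_loop : cmd :=
  While (ILe 29 27)
    (Seq (block [:: ISub 19 29 28; ILoad 30 19; IAdd 19 29 28; ILoad 31 19])
    (Seq scan_prog
         (Do (IAdd 29 29 36)))).

Definition halving_loop : cmd :=
  While (ILe 3 28)
    (Seq (block (IAdd 36 28 28 :: copy 29 28))
    (Seq row_loop
         (Do (IHalf 28 28)))).

(** Row L lies outside the square. Its cell holds the last column as a sentinel, which bounds the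
    search in rows below the last known one. *)
Definition square_prog : cmd :=
  Seq (block [:: IStore 11 27, IConst 29 0, IConst 30 0 & copy 31 27])
  (Seq scan_prog
  (Seq (Do (IHalf 28 11))
       halving_loop)).

Definition curvature_loop : cmd :=
  While (ILe 18 15)
    (Seq (block [:: IAdd 19 4 18; ISub 19 19 3; DLoad 0 19; ISub 19 19 3;
                    DLoad 1 19; ISub 19 19 3; DLoad 2 19; DAdd 0 0 2; DAdd 1 1 1])
    (Seq (If (DLe 1 0) Skip (Do (IConst 16 0)))
    (Seq (If (DLe 0 1) Skip (Do (IConst 17 0)))
         (Do (IAdd 18 18 3))))).

Definition curvature_prog : cmd :=
  Seq (block [:: IConst 16 1; IConst 17 1; IAdd 18 14 3; IAdd 18 18 3; IAdd 18 18 3])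
      curvature_loop.

(** Register 14 is compared with the width before the subtraction, which is truncated. The sum of
    the flags 16 and 17 serves as their disjunction. *)
Definition good_prog (w : nat) : cmd :=
  Seq (block [:: IConst 20 0; IAdd 14 13 3; IAdd 15 13 w])
      (If (ILe w 14)
        (If (ILe 15 1)
          (Seq (Do (ISub 14 14 w))
          (Seq curvature_prog
          (Seq (Do (IAdd 19 16 17))
               (If (ILe 3 19) (Do (IConst 20 1)) Skip))))
          Skip)
        Skip).

Definition diagonal_loop : cmd :=
  While (ILe 23 0)
    (Seq (block [:: ISub 24 23 11; ISub 25 24 13; IAdd 26 24 27])
    (Seq square_prog
         (Do (IAdd 23 23 11)))).

Definition diagonal_prog : cmd := Seq (Do (IAdd 23 13 11)) diagonal_loop.

(** At an offset that is good in the wide sense, every square lies in a larger good one and is left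
    to it. *)
Definition offset_prog : cmd :=
  Seq (good_prog 22)
      (If (ILe 3 20) Skip
        (Seq (good_prog 11) (If (ILe 3 20) diagonal_prog Skip))).

Definition level_loop : cmd :=
  While (ILe 12 0)
    (Seq (Do (ISub 13 12 11))
    (Seq offset_prog
         (Do (IAdd 12 12 11)))).

Definition levels_loop : cmd :=
  While (ILe 11 0)
    (Seq (block [:: IAdd 22 11 11, IAdd 22 22 11, ISub 27 11 3 & copy 12 11])
    (Seq level_loop
         (Do (IAdd 11 11 11)))).

Definition levels_prog : cmd := Seq (Do (IConst 11 1)) levels_loop.

Definition setup_prog : cmd :=
  block [:: IConst 3 1; IAdd 4 0 2; IAdd 4 4 3; IAdd 5 4 1; ISub 6 0 3;
            ISub 7 1 3; IConst 8 0].

Definition power_sum_loop : cmd :=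
  While (ILe 9 2)
    (block [:: IAdd 10 0 9; DLoad 3 10; DMul 3 3 2; DAdd 1 1 3; DMul 2 2 0;
               IAdd 9 9 3]).

(** The 0 and 1 that start the power sum come from [DSub 1 1 1] and from converting index register
    3, as programs contain no field constants. *)
Definition evaluation_loop : cmd :=
  While (ILe 8 7)
    (Seq (block [:: DOfIndex 0 8; DSub 1 1 1; DOfIndex 2 3; IConst 9 0])
    (Seq power_sum_loop
         (block [:: IAdd 10 4 8; DStore 10 1; IAdd 8 8 3]))).

Definition first_terms_loop : cmd :=
  While (ILe 8 6)
    (block [:: DLoad 0 8; DAdd 0 0 1; IAdd 10 5 8; DStore 10 0; IAdd 8 8 3]).

Definition output_loop : cmd :=
  While (ILe 8 6)
    (block [:: IAdd 10 5 8; DLoad 0 10; DStore 8 0; IAdd 8 8 3]).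

Definition window_prog : cmd :=
  Seq setup_prog
  (Seq evaluation_loop
  (Seq (block [:: IConst 8 0; DLoad 1 4])
  (Seq first_terms_loop
  (Seq levels_prog
  (Seq (Do (IConst 8 0))
       output_loop))))).

(** * Convexity *)

Section Curvature.
Variable R : realFieldType.
Implicit Type h : nat -> R.

(** The range is half-open: [hi - lo] values have [hi - lo - 2] second differences, so at most two
    values are both convex and concave. *)
Definition convex h (lo hi : nat) : bool :=
  all (fun i => h i.+1 + h i.+1 <= h i.+2 + h i) (iota lo (hi - lo - 2)).

Definition concave h (lo hi : nat) : bool :=
  all (fun i => h i.+2 + h i <= h i.+1 + h i.+1) (iota lo (hi - lo - 2)).

Lemma concaveN h lo hi : concave h lo hi = convex (fun i => - h i) lo hi.
Proof. by apply: eq_all => i /=; rewrite -!opprD lerN2. Qed.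

(** First differences do not decrease along the range ([slope]); [s] of them are added up from [x]
    and from [y]. *)
Lemma convex_exchange h lo hi x y s :
  convex h lo hi -> (lo <= x <= y)%N -> (y + s < hi)%N ->
  h (x + s)%N + h y <= h (y + s)%N + h x.
Proof.
move=> /allP cv.
have slope z k : (lo <= z)%N -> (z + k.+1 < hi)%N ->
    h z.+1 - h z <= h (z + k.+1)%N - h (z + k)%N.
  elim: k => [|k IHk] lz zk; first by rewrite addn1 addn0.
  have := IHk lz ltac:(lia); have := cv (z + k)%N; rewrite mem_iota !addnS.
  by move=> /(_ ltac:(lia)); lra.
move=> /andP[lx xy]; elim: s => [|s IHs] ys; first by rewrite !addn0 addrC.
have := IHs ltac:(lia); have := slope (x + s)%N (y - x)%N ltac:(lia) ltac:(lia).
have -> : (x + s + (y - x).+1 = (y + s.+1))%N by lia.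
have -> : (x + s + (y - x) = (y + s))%N by lia.
by rewrite !addnS; lra.
Qed.

End Curvature.

(** * Correctness and running time *)

Section Program.
Variables (R : realFieldType) (n m B C : nat) (a b : nat -> R).
Hypotheses (nB : (n <= B)%N) (BC : C = (B + m)%N).
Implicit Types s : state R.

Record regs s : Prop := Regs {
  regs_n : ireg s 0 = n;
  regs_m : ireg s 1 = m;
  regs_1 : ireg s 3 = 1%N;
  regs_B : ireg s 4 = B;
  regs_C : ireg s 5 = C;
  regs_0 : dreg s 9 = 0 }.

Lemma regs_frame c s s' :
  frame c s s' ->
  all (fun x => ~~ occurs (iwrites_instr^~ x) c) [:: 0; 1; 3; 4; 5]%N &&
    ~~ occurs (dwrites_instr^~ 9%N) c ->
  regs s -> regs s'.
Proof.
move=> [fi fd _ _] /andP[/and5P[h0 h1 h3 h4 /andP[h5 _]] h9] [? ? ? ? ? ?].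
by split; rewrite ?fi ?fd.
Qed.

Definition data s : Prop :=
  (forall j, (j < n)%N -> dmem s j = a j) /\
  (forall i, (i < m)%N -> dmem s (B + i) = b i).

Lemma data_low s s' :
  (forall x, (x < C)%N -> dmem s' x = dmem s x) -> data s -> data s'.
Proof.
by move=> e [da db]; split=> x xn; rewrite e ?BC; [exact: da|lia|exact: db|lia].
Qed.

(** A cell that is itself a candidate is at least the minimum. Rows beyond [n - m] are included
    because squares may reach them. *)
Definition sound s : Prop :=
  forall k, (k < n)%N ->
    exists2 i, (i < m)%N & dmem s (C + k)%N = a (k + i)%N + b i.

(** Cells only decrease, so an upper bound reached at one square survives all later ones. *)
Definition improves s s' : Prop :=
  [/\ forall x, (x < C)%N -> dmem s' x = dmem s x,
      forall x, dmem s' x <= dmem s x & sound s -> sound s'].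

Lemma improves_eq s s' : dmem s' = dmem s -> improves s s'.
Proof. by move=> e; split=> [x|x|snd k kn]; rewrite e //; apply: snd. Qed.

Lemma improves_trans s1 s2 s3 :
  improves s1 s2 -> improves s2 s3 -> improves s1 s3.
Proof.
move=> [l1 m1 c1] [l2 m2 c2]; split=> [x xC|x|snd]; last exact/c2/c1.
  by rewrite l2 ?l1.
exact: le_trans (m2 x) (m1 x).
Qed.

(** * Row minima of one Monge square *)

Section Square.
Variables (u : bool) (L jlo kb : nat).
Hypotheses (jn : (jlo + L <= n)%N) (kj : (kb + L <= jlo.+1)%N)
  (jm : (jlo + L <= kb + m)%N).

Definition column (t : nat) : nat := if u then (jlo + t)%N else (jlo + L.-1 - t)%N.

Definition entry (r t : nat) : R := a (column t) + b (column t - (kb + r))%N.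

Record square_regs s : Prop := SquareRegs {
  square_L : ireg s 11 = L;
  square_u : ireg s 16 = u;
  square_j : ireg s 24 = jlo;
  square_k : ireg s 25 = kb;
  square_h : ireg s 26 = (jlo + L.-1)%N;
  square_l : ireg s 27 = L.-1 }.

Lemma square_regs_frame c s s' :
  frame c s s' ->
  all (fun x => ~~ occurs (iwrites_instr^~ x) c) [:: 11; 16; 24; 25; 26; 27]%N ->
  square_regs s -> square_regs s'.
Proof.
move=> [fi _ _ _] /and5P[h0 h1 h3 h4 /and3P[h5 h6 _]] [? ? ? ? ? ?].
by split; rewrite fi.
Qed.

Lemma entry_progP s r t :
  regs s -> data s -> square_regs s -> (r < L)%N -> (t < L)%N ->
  ireg s 32 = (kb + r)%N -> ireg s 33 = t ->
  runs entry_prog s (fun tau s' =>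
    [/\ tau = 7%N, dreg s' 0%N = entry r t & dreg s' 1%N = dreg s 1%N]).
Proof.
move=> [_ _ s3 s4 _ _] [da db] [_ s16 s24 _ s26 _] rL tL s32 s33.
have jn' : (column t < n)%N by rewrite /column; case: ifP; lia.
have im : (column t - (kb + r) < m)%N by rewrite /column; case: ifP; lia.
apply: runs_seq; apply: runs_if; rewrite /= s3 s16 => hu;
  apply: runs_do; apply: runs_block; split=> //=;
  rewrite ?s24 ?s26 s33 s32 s4 /entry /column; move: jn' im; rewrite /column.
- have -> : u by case: (u) hu.
  by move=> jn' im; rewrite da // db.
- have /negbTE -> : ~~ u by case: (u) hu.
  by move=> jn' im; rewrite da // db.
Qed.

Lemma scan_progP s r lo hi :
  regs s -> data s -> square_regs s -> (r < L)%N -> (lo <= hi < L)%N ->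
  ireg s 29 = r -> ireg s 30 = lo -> ireg s 31 = hi ->
  runs scan_prog s (fun tau s' =>
    (tau <= 13 * (hi - lo) + 40)%N /\
    exists o, [/\ (lo <= o <= hi)%N,
      forall t, (lo <= t <= hi)%N -> entry r o <= entry r t,
      imem s' = [eta imem s with r |-> o] &
      forall x, dmem s' x =
        if x == (C + (kb + r))%N then Num.min (dmem s x) (entry r o)
        else dmem s x]).
Proof.
move=> rs ds qs rL /andP[lohi hiL] s29 s30 s31.
have loL : (lo < L)%N by lia.
apply: runs_seq; apply: runs_frame; apply: runs_block => fr1.
set s1 := foldl _ _ _ in fr1 *.
have rs1 := regs_frame fr1 isT rs; have qs1 := square_regs_frame fr1 isT qs.
have ds1 : data s1 by apply: data_low ds.
have s1_32 : ireg s1 32 = (kb + r)%N by rewrite /= s29 (square_k qs).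
have s1_33 : ireg s1 33 = lo by rewrite /= s30.
have s1_29 : ireg s1 29 = r by [].
have s1_31 : ireg s1 31 = hi by [].
have im1 : imem s1 = imem s by [].
have dm1 : dmem s1 = dmem s by [].
move: s1 {fr1} rs1 qs1 ds1 s1_32 s1_33 s1_29 s1_31 im1 dm1.
move=> s1 rs1 qs1 ds1 s1_32 s1_33 s1_29 s1_31 im1 dm1.
apply: runs_seq; apply: (runs_conseq (entry_progP rs1 ds1 qs1 rL loL s1_32 s1_33)).
move=> _ s2 fr2 [-> s2_0 _]; have [fi fd fm fn] := fr2.
have rs2 := regs_frame fr2 isT rs1; have qs2 := square_regs_frame fr2 isT qs1.
apply: runs_seq; apply: runs_frame; apply: runs_block => fr3.
set s3 := foldl _ _ _ in fr3 *.
have rs3 := regs_frame fr3 isT rs2; have qs3 := square_regs_frame fr3 isT qs2.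
have s3_1 : dreg s3 1%N = entry r lo by rewrite /= s2_0 (regs_0 rs2) addr0.
have s3_34 : ireg s3 34 = lo by rewrite /= (fi 33%N isT).
have s3_33 : ireg s3 33 = lo by rewrite /= (fi 33%N isT).
have s3_32 : ireg s3 32 = (kb + r)%N by rewrite /= (fi 32%N isT).
have s3_29 : ireg s3 29 = r by rewrite /= (fi 29%N isT).
have s3_31 : ireg s3 31 = hi by rewrite /= (fi 31%N isT).
have im3 : imem s3 = imem s by rewrite /= (fm isT).
have dm3 : dmem s3 = dmem s by rewrite /= (fn isT).
move: s3 {fi fd fm fn fr2 rs2 qs2 s2_0 fr3} rs3 qs3 s3_1 s3_34 s3_33 s3_32 s3_29 s3_31 im3 dm3.
move=> s3 rs3 qs3 s3_1 s3_34 s3_33 s3_32 s3_29 s3_31 im3 dm3.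
have ds3 : data s3 by rewrite /data dm3.
apply: runs_seq.
(* An iteration costs at most 13: the loop test, 7 for the entry, 4 for comparison and update, 1 for
   the increment. *)
pose I i tau s' := [/\ (tau <= 13 * i)%N, ireg s' 33 = (lo + i)%N,
  (lo <= ireg s' 34 <= hi)%N, dreg s' 1%N = entry r (ireg s' 34) &
  forall t, (lo <= t < lo + i)%N -> dreg s' 1%N <= entry r t].
apply: (@runs_while _ _ _ _ (hi - lo).+1 I).
- rewrite /I s3_34 s3_33 s3_1 addn0 leqnn lohi; split=> // t; lia.
- move=> i tau s4 iN fr [tauI s33 s34 s4_1 opt]; have [fi fd fm fn] := fr.
  have rs4 := regs_frame fr isT rs3; have qs4 := square_regs_frame fr isT qs3.
  have ds4 : data s4 by rewrite /data (fn isT).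
  have s4_32 : ireg s4 32 = (kb + r)%N by rewrite (fi 32%N isT).
  have tL : (lo + i < L)%N by lia.
  split; first by rewrite /= s33 (fi 31%N isT) s3_31; lia.
  apply: runs_seq; apply: (runs_conseq (entry_progP rs4 ds4 qs4 rL tL s4_32 s33)).
  move=> _ s5 fr5 [-> s5_0 s5_1]; have [gi gd gm gn] := fr5.
  have rs5 := regs_frame fr5 isT rs4.
  apply: runs_seq; apply: runs_if; rewrite /= s5_1 s5_0 => hb.
    apply: runs_skip; apply: runs_do => _; split; rewrite /= ?(gi 33%N isT) ?(gi 34%N isT) //.
    + lia.
    + by rewrite s33 (regs_1 rs5); lia.
    + by rewrite s5_1.
    + rewrite s5_1 => t /andP[lt ti]; case: (eqVneq t (lo + i)%N) => [->//|ne].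
      by apply: opt; lia.
  rewrite -ltNge in hb.
  apply: (@runs_block _ [:: _; _; _]); apply: runs_do => _.
  split; rewrite /= ?(gi 33%N isT) ?(regs_0 rs5) ?addr0 ?s5_0 ?add0n ?s33 //.
  + lia.
  + by rewrite (regs_1 rs5); lia.
  + lia.
  + move=> t /andP[lt ti]; case: (eqVneq t (lo + i)%N) => [->//|ne].
    by apply/ltW/(lt_le_trans hb)/opt; lia.
move=> tau s4 fr [tauI s33 s34 s4_1 opt]; have [fi fd fm fn] := fr.
have rs4 := regs_frame fr isT rs3.
split; first by rewrite /= s33 (fi 31%N isT) s3_31; lia.
apply: runs_seq; apply: runs_block.
set o := ireg s4 34 in s34 s4_1.
have e32 : ireg s4 32 = (kb + r)%N by rewrite (fi 32%N isT).
have e29 : ireg s4 29 = r by rewrite (fi 29%N isT).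
have mo t : (lo <= t <= hi)%N -> entry r o <= entry r t.
  by move=> ht; rewrite -s4_1; apply: opt; lia.
apply: runs_if; rewrite /= s4_1 e32 e29 (regs_C rs4) (fn isT) dm3 => hb.
  apply: runs_skip; split; first by rewrite /=; lia.
  exists o; split=> //= [|x]; rewrite ?(fm isT) ?im3 ?(fn isT) ?dm3 ?e29 //.
  by case: eqP => // ->; rewrite min_l.
apply: runs_do; split; first by rewrite /=; lia.
exists o; split=> //= [|x]; rewrite ?(fm isT) ?im3 ?(fn isT) ?dm3 ?e29 //.
rewrite ?s4_1 ?e32 ?(regs_C rs4).
by case: eqP => // ->; rewrite min_r // ltW // ltNge.
Qed.

Definition argmin (r o : nat) : Prop :=
  forall t, (t < L)%N -> entry r o <= entry r t.

Definition monge : Prop := forall r r' t t',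
  (r <= r' < L)%N -> (t <= t' < L)%N ->
  entry r t + entry r' t' <= entry r t' + entry r' t.

Hypothesis L0 : (0 < L)%N.
Hypothesis Mon : monge.

(** A column left of [o1] is exchanged against [o1] using row [r1], where [o1] is optimal; likewise
    on the right with row [r2]. If [r2] is the sentinel, no column lies to the right of [o2]. *)
Lemma argmin_between r1 r r2 o1 o o2 :
  (r1 <= r <= r2)%N -> (r < L)%N -> (o1 <= o <= o2)%N -> (o2 < L)%N ->
  argmin r1 o1 -> ((r2 < L)%N -> argmin r2 o2) -> ((L <= r2)%N -> o2 = L.-1) ->
  (forall t, (o1 <= t <= o2)%N -> entry r o <= entry r t) -> argmin r o.
Proof.
move=> /andP[r1r rr2] rL /andP[o1o oo2] o2L m1 m2 e2 mo t tL.
have [to1|o1t] := ltnP t o1.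
  have ho1 : entry r o <= entry r o1 by apply: mo; lia.
  have ht := m1 t tL.
  have := @Mon r1 r t o1 ltac:(lia) ltac:(lia); lra.
have [to2|o2t] := leqP t o2; first by apply: mo; lia.
have r2L : (r2 < L)%N by case: (ltnP r2 L) => // /e2; lia.
have ho2 : entry r o <= entry r o2 by apply: mo; lia.
have ht := m2 r2L t tL.
have := @Mon r r2 o2 t ltac:(lia) ltac:(lia); lra.
Qed.

(** In use [N * G = L], so row [N * G] is the sentinel: it bounds columns, and no minimality is
    claimed for it. *)
Record row_minima (G N : nat) s : Prop := RowMinima {
  row_last : imem s (N * G)%N = L.-1;
  row_argmin : forall e, (e < N)%N -> argmin (e * G) (imem s (e * G)%N);
  row_monotone : forall e, (e < N)%N -> (imem s (e * G) <= imem s (e.+1 * G))%N;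
  row_cover : forall e t, (e < N)%N -> (t < L)%N ->
    dmem s (C + (kb + e * G))%N <= entry (e * G) t }.

Lemma row_minima_bound G N s e :
  row_minima G N s -> (e <= N)%N -> (imem s (e * G) <= L.-1)%N.
Proof.
move=> [<- _ mon _]; move: N mon => N mon eN.
have step k : (e + k <= N)%N -> (imem s (e * G) <= imem s ((e + k) * G))%N.
  elim: k => [|k IHk] kN; first by rewrite addn0.
  by apply: leq_trans (IHk _) _; rewrite ?addnS; [lia|apply: mon; lia].
by have := step (N - e)%N; rewrite subnKC // => -> //.
Qed.

(** Soundness survives because the new value is the old one or an entry of the square, and the
    bounds on the square make every entry a legal candidate. *)
Lemma scan_prog_improves s r lo hi :
  regs s -> data s -> square_regs s -> (r < L)%N -> (lo <= hi < L)%N ->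
  ireg s 29 = r -> ireg s 30 = lo -> ireg s 31 = hi ->
  runs scan_prog s (fun tau s' =>
    (tau <= 13 * (hi - lo) + 40)%N /\
    exists o, [/\ (lo <= o <= hi)%N,
      forall t, (lo <= t <= hi)%N -> entry r o <= entry r t,
      imem s' = [eta imem s with r |-> o],
      improves s s' & dmem s' (C + (kb + r))%N <= entry r o]).
Proof.
move=> rs ds qs rL hL s29 s30 s31.
apply: (runs_conseq (scan_progP rs ds qs rL hL s29 s30 s31)).
move=> tau s' fr [-> [o [oL mo im dm]]]; split=> //; exists o; split=> //; last first.
  by rewrite dm eqxx ge_min lexx orbT.
split=> [x xC|x|snd k kn].
- by rewrite dm; case: eqP => // ?; lia.
- by rewrite dm; case: eqP => // _; rewrite ge_min lexx.
rewrite dm eqn_add2l; case: eqP => [->|_]; last exact: snd.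
rewrite /Num.min; case: ifP => _; first by apply: snd; lia.
have cL : (column o < jlo + L)%N by rewrite /column; case: ifP; lia.
have cj : (jlo <= column o)%N by rewrite /column; case: ifP; lia.
exists (column o - (kb + r))%N; first by lia.
by rewrite /entry subnKC //; lia.
Qed.

Lemma row_loopP s H N :
  regs s -> data s -> square_regs s -> (0 < H)%N -> (N * (H + H) = L)%N ->
  ireg s 28 = H -> ireg s 36 = (H + H)%N -> ireg s 29 = H ->
  row_minima (H + H) N s ->
  runs row_loop s (fun tau s' =>
    [/\ (tau <= 59 * L + 1)%N, improves s s' & row_minima H (N * 2) s']).
Proof.
move=> rs ds qs H0 NL s28 s36 s29 mins.
have bnd := row_minima_bound mins.
have [last amin mono cov] := mins.
pose odd_row q := (q.*2.+1 * H)%N.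
(* The widths of the searched ranges telescope, so one pass over the rows is linear in [L]. The 46
   is the 40 of a scan plus 6 for the loop. *)
pose I q tau s' := [/\ (tau <= 46 * q + 13 * imem s (q * (H + H)))%N,
  ireg s' 29 = odd_row q, improves s s',
  forall e, imem s' (e * (H + H))%N = imem s (e * (H + H))%N &
  forall e, (e < q)%N ->
    [/\ argmin (odd_row e) (imem s' (odd_row e)),
      (imem s (e * (H + H)) <= imem s' (odd_row e) <= imem s (e.+1 * (H + H)))%N &
      forall t, (t < L)%N -> dmem s' (C + (kb + odd_row e))%N <= entry (odd_row e) t]].
apply: (@runs_while _ _ _ _ N I).
- by split=> //; rewrite s29 /odd_row mul1n.
- move=> q tau s1 qN fr [tauI t29 imp ev od]; have [fi fd fm fn] := fr.
  have rs1 := regs_frame fr isT rs; have qs1 := square_regs_frame fr isT qs.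
  have ds1 : data s1 by case: imp => low _ _; apply: (data_low low).
  have rL : (odd_row q < L)%N by rewrite /odd_row; nia.
  split; first by rewrite /= t29 (square_l qs1); lia.
  apply: runs_seq; apply: runs_frame; apply: runs_block => fr2.
  set s2 := foldl _ _ _ in fr2 *.
  have rs2 := regs_frame fr2 isT rs1; have qs2 := square_regs_frame fr2 isT qs1.
  have dm2 : dmem s2 = dmem s1 by [].
  have im2 : imem s2 = imem s1 by [].
  have ds2 : data s2 by rewrite /data dm2.
  have s2_29 : ireg s2 29 = odd_row q by [].
  have s2_30 : ireg s2 30 = imem s (q * (H + H))%N.
    by rewrite /= t29 (fi 28%N isT) s28 -ev /odd_row; congr (imem s1 _); lia.
  have s2_31 : ireg s2 31 = imem s (q.+1 * (H + H))%N.
    by rewrite /= t29 (fi 28%N isT) s28 -ev /odd_row; congr (imem s1 _); lia.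
  have s2_36 : ireg s2 36 = (H + H)%N by rewrite /= (fi 36%N isT).
  move: s2 fr2 rs2 qs2 dm2 im2 ds2 s2_29 s2_30 s2_31 s2_36.
  move=> s2 fr2 rs2 qs2 dm2 im2 ds2 s2_29 s2_30 s2_31 s2_36.
  have := mono q qN; have := bnd q.+1 qN.
  set lo := imem s (q * _)%N in s2_30 tauI *.
  set hi := imem s (q.+1 * _)%N in s2_31 *.
  move=> hiL lohi; have lh : (lo <= hi < L)%N by lia.
  apply: runs_seq.
  apply: (runs_conseq (scan_prog_improves rs2 ds2 qs2 rL lh s2_29 s2_30 s2_31)).
  move=> t2 s3 fr3 [t2I [o [oI mo im3 imp3 c3]]]; have [gi _ _ _] := fr3.
  apply: runs_do => _; split=> /=.
  + by rewrite -/hi; lia.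
  + by rewrite (gi 29%N isT) (gi 36%N isT) s2_29 s2_36 /odd_row; lia.
  + apply: improves_trans imp _; rewrite /improves /sound /= -dm2; exact: imp3.
  (* An odd multiple of [H] is no multiple of [H + H], so the known rows keep their cells. *)
  + move=> e; rewrite im3 /= im2; case: eqP => [eq|_]; last exact: ev.
    have : (e.*2 * H = q.*2.+1 * H)%N by rewrite -/(odd_row q) -eq; lia.
    by move/eqP; rewrite eqn_pmul2r //; lia.
  + have amo : argmin (odd_row q) o.
      apply: (@argmin_between (q * (H + H)) _ (q.+1 * (H + H)) lo _ hi); try by [].
      * by rewrite /odd_row; lia.
      * by lia.
      * exact: amin.
      * by move=> lt; apply: amin; nia.
      * by move=> ge; rewrite -last; congr (imem s _); nia.
    move=> e; rewrite ltnS leq_eqVlt => /orP[/eqP->|eq].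
      rewrite im3 /= eqxx; split=> // t tL; exact: le_trans c3 (amo t tL).
    have [o1 o2 o3] := od e eq.
    have ne : (odd_row e == odd_row q) = false by apply/eqP; rewrite /odd_row; nia.
    rewrite im3 /= im2 ne; split=> // t tL.
    by case: imp3 => _ mon _; apply: le_trans (mon _) _; rewrite dm2; apply: o3.
move=> tau s1 fr [tauI t29 imp ev od].
have qs1 := square_regs_frame fr isT qs.
split; first by rewrite /= t29 (square_l qs1) /odd_row; nia.
split=> //; first by move: tauI; rewrite last; nia.
have evE q : (q.*2 * H = q * (H + H))%N by lia.
have half e : (e < N * 2)%N -> exists2 q, (q < N)%N & e = q.*2 \/ e = q.*2.+1.
  move=> eN; exists e./2; first by lia.
  by have := odd_double_half e; case: (odd e); [right|left]; lia.
split.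
- by rewrite -last -ev; congr (imem s1 _); lia.
- move=> e /half[q qN [->|->]]; last by have [] := od q qN.
  by rewrite evE ev; apply: amin.
- move=> e /half[q qN [->|->]]; have [_ /andP[h1 h2] _] := od q qN.
    by rewrite evE ev.
  by rewrite -doubleS evE ev.
- move=> e t /half[q qN [->|->]] tL; last by have [_ _] := od q qN; apply.
  by rewrite evE; case: imp => _ mon _; apply: le_trans (mon _) _; apply: cov.
Qed.

(** After a full scan of row 0, each of the [p] halvings costs at most [59 * L + 6]; at distance 1
    every row is known. *)
Lemma square_progP s p :
  L = (2 ^ p)%N -> regs s -> data s -> square_regs s ->
  runs square_prog s (fun tau s' =>
    [/\ (tau <= 65 * (L * p.+1))%N, improves s s' &
      forall r t, (r < L)%N -> (t < L)%N -> dmem s' (C + (kb + r))%N <= entry r t]).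
Proof.
move=> Lp rs ds qs.
apply: runs_seq; apply: runs_frame; apply: runs_block => fr1.
set s1 := foldl _ _ _ in fr1 *.
have rs1 := regs_frame fr1 isT rs; have qs1 := square_regs_frame fr1 isT qs.
have dm1 : dmem s1 = dmem s by [].
have ds1 : data s1 by rewrite /data dm1.
have im1 : imem s1 L = L.-1 by rewrite /= (square_L qs) (square_l qs) eqxx.
have s1_29 : ireg s1 29 = 0%N by [].
have s1_30 : ireg s1 30 = 0%N by [].
have s1_31 : ireg s1 31 = L.-1 by rewrite /= (square_l qs).
move: s1 {fr1} rs1 qs1 dm1 ds1 im1 s1_29 s1_30 s1_31.
move=> s1 rs1 qs1 dm1 ds1 im1 s1_29 s1_30 s1_31.
have lh : (0 <= L.-1 < L)%N by lia.
apply: runs_seq; apply: (runs_conseq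
  (scan_prog_improves rs1 ds1 qs1 L0 lh s1_29 s1_30 s1_31)).
move=> t2 s2 fr2 [t2I [o [oI mo im2 imp2 c2]]].
have rs2 := regs_frame fr2 isT rs1; have qs2 := square_regs_frame fr2 isT qs1.
apply: runs_seq; apply: runs_frame; apply: runs_do => fr3.
set s3 := step _ _ in fr3 *.
have rs3 := regs_frame fr3 isT rs2; have qs3 := square_regs_frame fr3 isT qs2.
have im3 : imem s3 = imem s2 by [].
have dm3 : dmem s3 = dmem s2 by [].
have s3_28 : ireg s3 28 = L./2 by rewrite /= (square_L qs2).
have imp3 : improves s s3.
  apply: improves_trans (improves_eq dm1) _.
  by apply: improves_trans imp2 (improves_eq dm3).
have min3 : row_minima L 1 s3.
  have amo : argmin 0 o by move=> t tL; apply: mo; lia.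
  split; rewrite ?im3 ?im2 ?dm3.
  - by rewrite /= mul1n; case: eqP; [lia|].
  - by case=> //= _; rewrite ?mul0n.
  - by case=> //= _; rewrite ?mul0n ?mul1n ?eqxx; case: eqP; lia.
  - case=> //= t _ tL; rewrite ?mul0n; exact: le_trans c2 (amo t tL).
move: s3 {fr3} rs3 qs3 im3 dm3 s3_28 imp3 min3 => s3 rs3 qs3 im3 dm3 s3_28 imp3 min3.
(* Register 28 stays one halving ahead of the distance, so it reaches 0 exactly when all rows are
   known. *)
pose I x tau s' := [/\ (tau <= x * (59 * L + 6))%N, ireg s' 28 = (2 ^ (p - x))./2,
  improves s s' & row_minima (2 ^ (p - x)) (2 ^ x) s'].
apply: (@runs_while _ _ _ _ p I).
- by split=> //; rewrite subn0 -Lp.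
- move=> x tau s4 xp fr [tauI s28 imp4 min4].
  have rs4 := regs_frame fr isT rs3; have qs4 := square_regs_frame fr isT qs3.
  have ds4 : data s4 by case: imp4 => low _ _; apply: (data_low low).
  have e2 : (2 ^ (p - x) = 2 ^ (p - x.+1) + 2 ^ (p - x.+1))%N.
    by rewrite addnn -mul2n -expnS; congr expn; lia.
  move: (2 ^ (p - x))%N e2 s28 min4 (expn_gt0 2 (p - x.+1)) => G e2.
  rewrite {}e2 addnn doubleK -addnn /= => s28 min4 H0.
  set H := (2 ^ _)%N in s28 min4 H0 *.
  split; first by rewrite /= s28 (regs_1 rs4).
  apply: runs_seq; apply: runs_frame; apply: runs_block => fr5.
  set s5 := foldl _ _ _ in fr5 *.
  have rs5 := regs_frame fr5 isT rs4; have qs5 := square_regs_frame fr5 isT qs4.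
  have s5_28 : ireg s5 28 = H by [].
  have s5_36 : ireg s5 36 = (H + H)%N by rewrite /= s28.
  have s5_29 : ireg s5 29 = H by rewrite /= s28.
  have dm5 : dmem s5 = dmem s4 by [].
  have ds5 : data s5 by rewrite /data dm5.
  have min5 : row_minima (H + H) (2 ^ x) s5 by case: min4.
  have NL : (2 ^ x * (H + H) = L)%N.
    rewrite addnn -mul2n -expnS -expnD Lp; congr expn; lia.
  apply: runs_seq; apply: (runs_conseq
    (row_loopP rs5 ds5 qs5 H0 NL s5_28 s5_36 s5_29 min5)).
  move=> t6 s6 fr6 [t6I imp6 min6]; have [gi _ _ _] := fr6.
  apply: runs_do => _; split=> /=.
  + lia.
  + by rewrite (gi 28%N isT) s5_28.
  + apply: improves_trans imp4 _; rewrite /improves /sound /= -dm5; exact: imp6.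
  + by rewrite expnSr -/H; case: min6.
move=> tau s4 fr [tauI s28 imp4 min4].
have rs4 := regs_frame fr isT rs3.
rewrite subnn in s28 min4.
split; first by rewrite /= s28 (regs_1 rs4).
split=> //; first by rewrite /=; nia.
move=> r t rL tL; have := @row_cover _ _ _ min4 r t; rewrite muln1 -Lp; exact.
Qed.

End Square.

(** * Testing whether a range of [b] is good *)

Lemma curvature_progP s lo hi :
  regs s -> data s -> ireg s 14 = lo -> ireg s 15 = hi -> (hi <= m)%N ->
  runs curvature_prog s (fun tau s' =>
    [/\ (tau <= 15 * (hi - lo) + 6)%N, ireg s' 16 = convex b lo hi &
        ireg s' 17 = concave b lo hi]).
Proof.
move=> rs ds s14 s15 him.
apply: runs_seq; apply: runs_frame; apply: runs_block => fr1.
set s1 := foldl _ _ _ in fr1 *.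
have rs1 := regs_frame fr1 isT rs; have ds1 : data s1 by [].
have s1_15 : ireg s1 15 = hi by [].
(* Register 18 is one past the last index of the next triple, hence the shift by 3. *)
pose I i tau s' := [/\ (tau <= 15 * i)%N, ireg s' 18 = (lo + i + 3)%N,
  ireg s' 16 = all (fun i => b i.+1 + b i.+1 <= b i.+2 + b i) (iota lo i) &
  ireg s' 17 = all (fun i => b i.+2 + b i <= b i.+1 + b i.+1) (iota lo i)].
apply: (@runs_while _ _ _ _ (hi - lo - 2) I).
- by split=> //; rewrite /= s14 (regs_1 rs); lia.
- move=> i tau s2 iN fr [tauI t18 t16 t17]; have [fi _ _ fn] := fr.
  have rs2 := regs_frame fr isT rs1.
  have [_ db] : data s2 by rewrite /data (fn isT).
  split; first by rewrite /= t18 (fi 15%N isT) s1_15; lia.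
  have e2 : (B + (lo + i + 3) - 1 = B + (lo + i).+2)%N by lia.
  have e1 : (B + (lo + i).+2 - 1 = B + (lo + i).+1)%N by lia.
  have e0 : (B + (lo + i).+1 - 1 = B + (lo + i))%N by lia.
  apply: runs_seq; apply: runs_frame; apply: runs_block => fr3.
  set s3 := foldl _ _ _ in fr3 *; have [gi _ _ _] := fr3.
  have s3_0 : dreg s3 0%N = b (lo + i).+2 + b (lo + i)%N.
    by rewrite /= (regs_B rs2) (regs_1 rs2) t18 e2 e1 e0 !db //; lia.
  have s3_1 : dreg s3 1%N = b (lo + i).+1 + b (lo + i).+1.
    by rewrite /= (regs_B rs2) (regs_1 rs2) t18 e2 e1 !db //; lia.
  have s3_3 : ireg s3 3 = 1%N by rewrite (gi 3%N isT) (regs_1 rs2).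
  have s3_18 : ireg s3 18 = (lo + i + 3)%N by rewrite (gi 18%N isT).
  have s3_16 := gi 16%N isT; have s3_17 := gi 17%N isT.
  rewrite t16 in s3_16; rewrite t17 in s3_17.
  move: s3 {fr3 gi} s3_0 s3_1 s3_3 s3_18 s3_16 s3_17.
  move=> s3 s3_0 s3_1 s3_3 s3_18 s3_16 s3_17.
  have eI : iota lo i.+1 = iota lo i ++ [:: (lo + i)%N] by rewrite -addn1 iotaD.
  by apply: runs_seq; apply: runs_if; rewrite /= s3_0 s3_1 => h1;
    (apply: runs_skip || apply: runs_do);
    apply: runs_seq; apply: runs_if; rewrite /= s3_0 s3_1 => h2;
    (apply: runs_skip || apply: runs_do);
    apply: runs_do => _; rewrite /I eI !all_cat /= !andbT;
    rewrite ?s3_16 ?s3_17 ?s3_18 ?s3_3 ?h1 ?h2 ?(negbTE h1) ?(negbTE h2)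
      ?andbT ?andbF; split=> //; lia.
move=> tau s2 fr [tauI t18 t16 t17]; have [fi _ _ fn] := fr.
split; first by rewrite /= t18 (fi 15%N isT) s1_15; lia.
by split=> //=; lia.
Qed.

(** The differences in a square of side [w] are [D + y - x] with [x, y < w]. The first conjunct
    keeps them nonnegative, so truncated subtraction is exact on them. *)
Definition good (w D : nat) : bool :=
  [&& (w <= D.+1)%N, (D + w <= m)%N &
      convex b (D.+1 - w) (D + w) || concave b (D.+1 - w) (D + w)].

Lemma good_progP s r w D :
  regs s -> data s -> [&& r != 14, r != 15 & r != 20]%N ->
  ireg s r = w -> ireg s 13 = D ->
  runs (good_prog r) s (fun tau s' =>
    [/\ (tau <= 30 * w + 20)%N, ireg s' 20 = good w D &
        good w D -> ireg s' 16 = convex b (D.+1 - w) (D + w)]).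
Proof.
move=> rs ds /and3P[/negbTE r14 /negbTE r15 /negbTE r20] sr s13.
apply: runs_seq; apply: runs_frame; apply: runs_block => fr1.
set s1 := foldl _ _ _ in fr1 *.
have rs1 := regs_frame fr1 isT rs; have ds1 : data s1 by [].
have s1_20 : ireg s1 20 = 0%N by [].
have s1_14 : ireg s1 14 = D.+1 by rewrite /= s13 (regs_1 rs) addn1.
have s1_15 : ireg s1 15 = (D + w)%N by rewrite /= r14 r20 s13 sr.
have s1_r : ireg s1 r = w by rewrite /= r14 r15 r20.
move: s1 {fr1} rs1 ds1 s1_20 s1_14 s1_15 s1_r => s1 rs1 ds1 s1_20 s1_14 s1_15 s1_r.
apply: runs_if; rewrite [eval_test _ _]/= s1_r s1_14 => h1; last first.
  have -> : good w D = false by rewrite /good (negbTE h1).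
  by apply: runs_skip; split=> //; rewrite /=; lia.
apply: runs_if; rewrite [eval_test _ _]/= (regs_m rs1) s1_15 => h2; last first.
  have -> : good w D = false by rewrite /good (negbTE h2) andbF.
  by apply: runs_skip; split=> //; rewrite /=; lia.
apply: runs_seq; apply: runs_frame; apply: runs_do => fr2.
set s2 := step _ _ in fr2 *.
have rs2 := regs_frame fr2 isT rs1; have ds2 : data s2 by [].
have s2_14 : ireg s2 14 = (D.+1 - w)%N by rewrite /= s1_r s1_14.
have s2_15 : ireg s2 15 = (D + w)%N by rewrite /= s1_15.
have s2_20 : ireg s2 20 = 0%N by rewrite /= s1_20.
apply: runs_seq; apply: (runs_conseq (curvature_progP rs2 ds2 s2_14 s2_15 h2)).
move=> t s3 fr3 [tI t16 t17]; have [gi _ _ _] := fr3.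
apply: runs_seq; apply: runs_do.
have g : good w D = convex b (D.+1 - w) (D + w) || concave b (D.+1 - w) (D + w).
  by rewrite /good h1 h2.
rewrite g.
by apply: runs_if; rewrite /= (gi 3%N isT) (regs_1 rs2) t16 t17 => h3;
  (apply: runs_do || apply: runs_skip); split=> //=; try lia;
  rewrite ?(gi 20%N isT) ?s2_20; move: h3; case: convex; case: concave.
Qed.

(** * The squares of one side length *)

Section Level.
Variables (p L : nat).
Hypothesis Lp : L = (2 ^ p)%N.

Let L0 : (0 < L)%N. Proof. by rewrite Lp expn_gt0. Qed.

(** The terms of [a] cancel, leaving the exchange inequality for [b] with shift [t' - t]. In the
    concave case the reversed columns lead to the same inequality for [- b]. *)
Lemma good_monge D kb :
  good L D ->
  monge (convex b (D.+1 - L) (D + L)) L (kb + D) kb.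
Proof.
move=> /and3P[h1 h2 h3] r r' t t' /andP[rr rL] /andP[tt tL].
rewrite /entry /column; case: ifP h3 => [cv _|_ /= cc].
  have := @convex_exchange _ b _ _ (D + t - r') (D + t - r) (t' - t) cv
            ltac:(lia) ltac:(lia).
  have -> : (D + t - r' + (t' - t) = kb + D + t' - (kb + r'))%N by lia.
  have -> : (D + t - r + (t' - t) = kb + D + t' - (kb + r))%N by lia.
  have -> : (D + t - r = kb + D + t - (kb + r))%N by lia.
  have -> : (D + t - r' = kb + D + t - (kb + r'))%N by lia.
  by lra.
rewrite concaveN in cc.
have := @convex_exchange _ _ _ _ (D + L.-1 - t' - r') (D + L.-1 - t' - r)
          (t' - t) cc ltac:(lia) ltac:(lia).
have -> : (D + L.-1 - t' - r' + (t' - t) = kb + D + L.-1 - t - (kb + r'))%N by lia.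
have -> : (D + L.-1 - t' - r + (t' - t) = kb + D + L.-1 - t - (kb + r))%N by lia.
have -> : (D + L.-1 - t' - r' = kb + D + L.-1 - t' - (kb + r'))%N by lia.
have -> : (D + L.-1 - t' - r = kb + D + L.-1 - t' - (kb + r))%N by lia.
by lra.
Qed.

Definition diagonal_done (N D : nat) s : Prop := forall q x y,
  (q < N)%N -> (x < L)%N -> (y < L)%N ->
  dmem s (C + (q * L + x))%N <= a (q * L + D + y)%N + b (D + y - x)%N.

Lemma diagonal_done_le N D s s' :
  (forall x, dmem s' x <= dmem s x) -> diagonal_done N D s -> diagonal_done N D s'.
Proof. by move=> le dn q x y qN xL yL; apply: le_trans (le _) (dn q x y qN xL yL). Qed.

(** Squares at one offset occupy disjoint columns, so their sides add up to at most [n]. *)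
Lemma diagonal_progP s delta (D := (delta * L)%N) :
  regs s -> data s -> good L D ->
  ireg s 11 = L -> ireg s 27 = L.-1 -> ireg s 13 = D ->
  ireg s 16 = convex b (D.+1 - L) (D + L) ->
  runs diagonal_prog s (fun tau s' =>
    [/\ (tau <= 71 * (n * p.+1) + 2)%N, improves s s' &
        diagonal_done (n %/ L - delta) D s']).
Proof.
move=> rs ds gd s11 s27 s13 s16; have /and3P[h1 h2 _] := gd.
apply: runs_seq; apply: runs_frame; apply: runs_do => fr1.
set s1 := step _ _ in fr1 *.
have rs1 := regs_frame fr1 isT rs; have ds1 : data s1 by [].
have dm1 : dmem s1 = dmem s by [].
have s1_11 : ireg s1 11 = L by [].
have s1_27 : ireg s1 27 = L.-1 by [].
have s1_13 : ireg s1 13 = D by [].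
have s1_16 : ireg s1 16 = convex b (D.+1 - L) (D + L) by [].
have s1_23 : ireg s1 23 = (D + L)%N by rewrite /= s13 s11.
move: s1 {fr1} rs1 ds1 dm1 s1_11 s1_27 s1_13 s1_16 s1_23.
move=> s1 rs1 ds1 dm1 s1_11 s1_27 s1_13 s1_16 s1_23.
(* This counts the squares of the given offset that fit into the [n] columns. *)
have inside q : (q * L + D + L <= n)%N = (q < n %/ L - delta)%N.
  by rewrite ltn_subRL -addnS leq_divRL // /D; congr leq; lia.
pose I q tau s' := [/\ (tau <= q * (65 * (L * p.+1) + 6))%N,
  ireg s' 23 = (q * L + D + L)%N, improves s s' & diagonal_done q D s'].
apply: (@runs_while _ _ _ _ (n %/ L - delta) I).
- by split; [| rewrite s1_23 | apply: improves_eq | move=> q x y].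
- move=> q tau s2 qN fr [tauI t23 imp dn]; have [fi _ _ _] := fr.
  have rs2 := regs_frame fr isT rs1.
  have ds2 : data s2 by case: imp => low _ _; apply: (data_low low).
  have qn : (q * L + D + L <= n)%N by rewrite inside.
  split; first by rewrite /= t23 (regs_n rs2).
  apply: runs_seq; apply: runs_frame; apply: runs_block => fr3.
  set s3 := foldl _ _ _ in fr3 *; have [gi _ _ _] := fr3.
  have rs3 := regs_frame fr3 isT rs2; have ds3 : data s3 by [].
  have e24 : (q * L + D + L - L = q * L + D)%N by lia.
  have qs3 : square_regs (convex b (D.+1 - L) (D + L)) L (q * L + D) (q * L) s3.
    split; rewrite ?(gi 11%N isT) ?(gi 16%N isT) ?(gi 27%N isT);
      rewrite ?(fi 11%N isT) ?(fi 16%N isT) ?(fi 27%N isT) //=;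
      rewrite ?(fi 11%N isT) ?(fi 27%N isT) ?(fi 13%N isT) t23 s1_11 ?s1_27 ?s1_13;
      lia.
  have s3_23 : ireg s3 23 = (q * L + D + L)%N by rewrite (gi 23%N isT).
  have s3_11 : ireg s3 11 = L by rewrite (gi 11%N isT) (fi 11%N isT).
  have dm3 : dmem s3 = dmem s2 by [].
  move: s3 {fr3 gi} rs3 ds3 qs3 s3_23 s3_11 dm3 => s3 rs3 ds3 qs3 s3_23 s3_11 dm3.
  have k1 : (q * L + L <= (q * L + D).+1)%N by lia.
  have k2 : (q * L + D + L <= q * L + m)%N by lia.
  apply: runs_seq; apply: (runs_conseq
    (square_progP qn k1 k2 L0 (good_monge (q * L) gd) Lp rs3 ds3 qs3)).
  move=> t4 s4 fr4 [t4I imp4 cov4]; have [gi _ _ _] := fr4.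
  have imp4' : improves s2 s4 by apply: improves_trans imp4; apply: improves_eq.
  apply: runs_do => _; split=> /=.
  + lia.
  + by rewrite (gi 23%N isT) (gi 11%N isT) s3_23 s3_11; lia.
  + by apply: improves_trans imp _; exact: imp4'.
  + move=> q' x y; rewrite ltnS leq_eqVlt => /orP[/eqP->|lt] xL yL; last first.
      by case: imp4' => _ le _; apply: le_trans (le _) (dn _ _ _ lt xL yL).
    (* In the mirrored case the column at distance [y] from the left has number [L.-1 - y]. *)
    have yL' : (L.-1 - y < L)%N by lia.
    have := cov4 x y xL yL; have := cov4 x _ xL yL'.
    rewrite /entry /column; case: ifP => _.
      have -> : (q * L + D + y - (q * L + x) = D + y - x)%N by lia.
      by [].
    have -> : (q * L + D + L.-1 - (L.-1 - y) = q * L + D + y)%N by lia.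
    have -> : (q * L + D + y - (q * L + x) = D + y - x)%N by lia.
    by [].
move=> tau s2 fr [tauI t23 imp dn].
have rs2 := regs_frame fr isT rs1.
split; first by rewrite /= t23 (regs_n rs2) inside ltnn.
split=> //.
have NL : ((n %/ L - delta) * L <= n)%N.
  by apply: leq_trans (leq_trunc_div n L); rewrite leq_mul2r leq_subr orbT.
move: tauI NL; move: (n %/ L - delta)%N => N tauI NL.
have : (N * (65 * (L * p.+1) + 6) <= 71 * (N * L * p.+1))%N by nia.
have : (N * L * p.+1 <= n * p.+1)%N by rewrite leq_mul2r NL orbT.
by lia.
Qed.

(** Squares at one offset can have parents at different offsets. The wide range contains the ranges
    of all these parents, so one test serves the whole offset. *)
Definition processed (delta : nat) : bool :=
  good L (delta * L) && ~~ good (3 * L) (delta * L).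

Lemma offset_progP s delta (D := (delta * L)%N) :
  regs s -> data s ->
  ireg s 11 = L -> ireg s 22 = (3 * L)%N -> ireg s 27 = L.-1 -> ireg s 13 = D ->
  runs offset_prog s (fun tau s' =>
    [/\ (tau <= 120 * L + 50 + processed delta * (71 * (n * p.+1)))%N,
        improves s s' &
        processed delta -> diagonal_done (n %/ L - delta) D s']).
Proof.
move=> rs ds s11 s22 s27 s13.
apply: runs_seq; apply: (runs_conseq (good_progP rs ds (r := 22) isT s22 s13)).
move=> t1 s1 fr1 [t1I t20 _]; have [fi _ _ fn] := fr1.
have rs1 := regs_frame fr1 isT rs.
have ds1 : data s1 by rewrite /data (fn isT).
have imp1 : improves s s1 by apply/improves_eq/fn.
apply: runs_if; rewrite [eval_test _ _]/= (regs_1 rs1) t20 => h1.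
  apply: runs_skip; rewrite /processed; split=> //; first lia.
  by move=> /andP[_]; move: h1; rewrite -/D; case: good.
have s1_11 : ireg s1 11 = L by rewrite (fi 11%N isT).
have s1_13 : ireg s1 13 = D by rewrite (fi 13%N isT).
apply: runs_seq; apply: (runs_conseq (good_progP rs1 ds1 (r := 11) isT s1_11 s1_13)).
move=> t2 s2 fr2 [t2I u20 u16]; have [gi _ _ gn] := fr2.
have rs2 := regs_frame fr2 isT rs1.
have ds2 : data s2 by rewrite /data (gn isT).
have imp2 : improves s s2 by apply: improves_trans imp1 _; apply/improves_eq/gn.
have ng : good (3 * L) D = false by move: h1; case: good.
apply: runs_if; rewrite [eval_test _ _]/= (regs_1 rs2) u20 => h2; last first.
  apply: runs_skip; rewrite /processed; split=> //; first lia.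
  by move=> /andP[]; move: h2; rewrite -/D; case: good.
have gd : good L D by move: h2; case: good.
have s2_11 : ireg s2 11 = L by rewrite (gi 11%N isT).
have s2_27 : ireg s2 27 = L.-1 by rewrite (gi 27%N isT) (fi 27%N isT).
have s2_13 : ireg s2 13 = D by rewrite (gi 13%N isT).
apply: (runs_conseq (diagonal_progP rs2 ds2 gd s2_11 s2_27 s2_13 (u16 gd))).
move=> t3 s3 fr3 [t3I imp3 dn]; split=> //; last exact: improves_trans imp2 imp3.
by rewrite /processed -/D gd ng /=; lia.
Qed.

Definition level_done s : Prop := forall delta,
  processed delta -> diagonal_done (n %/ L - delta) (delta * L) s.

Lemma level_loopP s E :
  (\sum_(delta < n %/ L) processed delta <= E)%N ->
  regs s -> data s ->
  ireg s 11 = L -> ireg s 22 = (3 * L)%N -> ireg s 27 = L.-1 -> ireg s 12 = L ->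
  runs level_loop s (fun tau s' =>
    [/\ (tau <= 173 * n + E * (71 * (n * p.+1)) + 1)%N, improves s s' &
        level_done s']).
Proof.
move=> cnt rs ds s11 s22 s27 s12.
(* The two tests, of widths [3 * L] and [L], cost O(L) at each of the [n %/ L] offsets, hence O(n)
   altogether. *)
pose I i tau s' := [/\ (tau <= i * (120 * L + 53) +
    (\sum_(delta < i) processed delta) * (71 * (n * p.+1)))%N,
  ireg s' 12 = (i * L + L)%N, improves s s' &
  forall delta, (delta < i)%N -> processed delta ->
    diagonal_done (n %/ L - delta) (delta * L) s'].
apply: (@runs_while _ _ _ _ (n %/ L) I).
- by split=> //; apply: improves_eq.
- move=> i tau s1 iN fr [tauI t12 imp dn]; have [fi _ _ _] := fr.
  have rs1 := regs_frame fr isT rs.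
  have ds1 : data s1 by case: imp => low _ _; apply: (data_low low).
  split; first by rewrite /= t12 (regs_n rs1) addnC -mulSn -leq_divRL.
  apply: runs_seq; apply: runs_frame; apply: runs_do => fr2.
  set s2 := step _ _ in fr2 *; have [gi _ _ _] := fr2.
  have rs2 := regs_frame fr2 isT rs1; have ds2 : data s2 by [].
  have s2_11 : ireg s2 11 = L by rewrite (gi 11%N isT) (fi 11%N isT).
  have s2_22 : ireg s2 22 = (3 * L)%N by rewrite (gi 22%N isT) (fi 22%N isT).
  have s2_27 : ireg s2 27 = L.-1 by rewrite (gi 27%N isT) (fi 27%N isT).
  have s2_12 : ireg s2 12 = (i * L + L)%N by rewrite (gi 12%N isT).
  have s2_13 : ireg s2 13 = (i * L)%N by rewrite /= t12 (fi 11%N isT) s11 addnK.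
  have imp2 : improves s s2 by exact: imp.
  apply: runs_seq; apply: (runs_conseq
    (offset_progP rs2 ds2 s2_11 s2_22 s2_27 s2_13)).
  move=> t3 s3 fr3 [t3I imp3 dn3]; have [hi _ _ _] := fr3.
  apply: runs_do => _; split=> /=.
  + rewrite big_ord_recr /= mulnDl; move: t3I tauI; set X := (71 * _)%N.
    by move: (nat_of_bool _ * X)%N ((\sum_(_ < _) _) * X)%N => Y Z; lia.
  + by rewrite (hi 12%N isT) (hi 11%N isT) s2_12 s2_11; lia.
  + exact: improves_trans imp2 imp3.
  + move=> delta; rewrite ltnS leq_eqVlt => /orP[/eqP->|lt]; first exact: dn3.
    move=> pr; case: imp3 => _ le _; apply: diagonal_done_le (dn _ lt pr).
    by move=> x; apply: (le x).
move=> tau s1 fr [tauI t12 imp dn]; have rs1 := regs_frame fr isT rs.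
split; first by rewrite /= t12 (regs_n rs1) addnC -mulSn -leq_divRL // ltnn.
split=> //; last first.
  (* From offset [n %/ L] on, no square fits and the claim is void. *)
  move=> delta pr; have [lt|ge] := ltnP delta (n %/ L); first exact: dn.
  by move=> q x y; rewrite ltn_subRL; lia.
have NL : (n %/ L * L <= n)%N := leq_trunc_div n L.
have : ((\sum_(delta < n %/ L) processed delta) * (71 * (n * p.+1)) <=
        E * (71 * (n * p.+1)))%N by rewrite leq_mul2r cnt orbT.
move: tauI NL; move: (n %/ L)%N (\sum_(_ < _) _)%N => N S tauI NL.
have : (N <= N * L)%N by rewrite leq_pmulr.
by lia.
Qed.

End Level.

(** [E] bounds the treated offsets uniformly in the side; the sides are the [(trunc_log 2 n).+1]
    powers of two up to [n]. *)
Lemma levels_progP s E :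
  (0 < n)%N ->
  (forall p, \sum_(delta < n %/ 2 ^ p) processed (2 ^ p) delta <= E)%N ->
  regs s -> data s ->
  runs levels_prog s (fun tau s' =>
    [/\ (tau <= (trunc_log 2 n).+1 *
           (182 * n + E * (71 * (n * (trunc_log 2 n).+1))) + 2)%N,
        improves s s' &
        forall p, (2 ^ p <= n)%N -> level_done (2 ^ p) s']).
Proof.
move=> n0 cnt rs ds; have /andP[lg1 lg2] := trunc_log_bounds (isT : (1 < 2)%N) n0.
set lg := trunc_log 2 n in lg1 lg2 *.
apply: runs_seq; apply: runs_frame; apply: runs_do => fr1.
set s1 := step _ _ in fr1 *.
have rs1 := regs_frame fr1 isT rs; have ds1 : data s1 by [].
pose I p tau s' := [/\ (tau <= p * (182 * n + E * (71 * (n * lg.+1))))%N,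
  ireg s' 11 = (2 ^ p)%N, improves s s' &
  forall p', (p' < p)%N -> level_done (2 ^ p') s'].
apply: (@runs_while _ _ _ _ lg.+1 I).
- by split=> //; apply: improves_eq.
- move=> p tau s2 pN fr [tauI t11 imp dn]; have [fi _ _ _] := fr.
  have rs2 := regs_frame fr isT rs1.
  have ds2 : data s2 by case: imp => low _ _; apply: (data_low low).
  have pn : (2 ^ p <= n)%N.
    by apply: leq_trans lg1; rewrite leq_exp2l.
  split; first by rewrite /= t11 (regs_n rs2).
  set L := (2 ^ p)%N in t11 pn *.
  apply: runs_seq; apply: runs_frame; apply: runs_block => fr3.
  set s3 := foldl _ _ _ in fr3 *; have [gi _ _ _] := fr3.
  have rs3 := regs_frame fr3 isT rs2; have ds3 : data s3 by [].
  have s3_11 : ireg s3 11 = L by rewrite (gi 11%N isT).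
  have s3_22 : ireg s3 22 = (3 * L)%N by rewrite /= t11; lia.
  have s3_27 : ireg s3 27 = L.-1 by rewrite /= t11 (regs_1 rs2) subn1.
  have s3_12 : ireg s3 12 = L by rewrite /= t11.
  have imp3 : improves s s3 by exact: imp.
  have dn3 : forall p', (p' < p)%N -> level_done (2 ^ p') s3 by exact: dn.
  move: s3 {fr3 gi} rs3 ds3 s3_11 s3_22 s3_27 s3_12 imp3 dn3.
  move=> s3 rs3 ds3 s3_11 s3_22 s3_27 s3_12 imp3 dn3.
  apply: runs_seq; apply: (runs_conseq
    (level_loopP (erefl : L = (2 ^ p)%N) (cnt p) rs3 ds3 s3_11 s3_22 s3_27 s3_12)).
  move=> t4 s4 fr4 [t4I imp4 dn4]; have [gi _ _ _] := fr4.
  apply: runs_do => _; split=> /=.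
  + have : (n * p.+1 <= n * lg.+1)%N by rewrite leq_mul2l pN orbT.
    by nia.
  + by rewrite (gi 11%N isT) s3_11 expnS; lia.
  + exact: improves_trans imp3 imp4.
  + move=> p'; rewrite ltnS leq_eqVlt => /orP[/eqP->//|lt] delta pr.
    by case: imp4 => _ le _; apply: diagonal_done_le (dn3 _ lt _ pr) => x; apply: (le x).
move=> tau s2 fr [tauI t11 imp dn]; have rs2 := regs_frame fr isT rs1.
split; first by rewrite /= t11 (regs_n rs2) -ltnNge.
split=> //; first by lia.
move=> p pn; apply: dn; rewrite ltnS -(leq_exp2l _ _ (isT : (1 < 2)%N)).
have : (2 ^ p < 2 ^ lg.+1)%N by apply: leq_ltn_trans pn lg2.
by rewrite !ltn_exp2l // !leq_exp2l.
Qed.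

End Program.

(** * The whole program and the covering of all candidates *)

Section Window.
Variables (R : realFieldType) (n m d : nat) (a b coef : nat -> R).
Hypotheses (m0 : (0 < m)%N) (mn : (m <= n)%N).
Hypothesis bE : forall i, b i = \sum_(e < d.+1) coef e * i%:R ^+ e.
Implicit Types s : state R.
Let B := (n + d.+1)%N.
Let C := (B + m)%N.
Notation regs := (regs n m B C).
Notation data := (data n m B a b).
Notation sound := (sound n m C a b).
Notation improves := (improves n m C a b).

Let nB : (n <= B)%N. Proof. exact: leq_addr. Qed.
Let BC : C = (B + m)%N. Proof. by []. Qed.

Lemma power_sum_loopP s (x : R) :
  regs s -> ireg s 2 = d -> ireg s 9 = 0%N ->
  dreg s 0%N = x -> dreg s 1%N = 0 -> dreg s 2%N = 1 ->
  (forall e, (e <= d)%N -> dmem s (n + e)%N = coef e) ->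
  runs power_sum_loop s (fun tau s' =>
    tau = (7 * d.+1 + 1)%N /\ dreg s' 1%N = \sum_(e < d.+1) coef e * x ^+ e).
Proof.
move=> rs s2 s9 d0 d1 d2 cf.
pose I e tau s' := [/\ tau = (7 * e)%N, ireg s' 9 = e,
  dreg s' 1%N = \sum_(i < e) coef i * x ^+ i & dreg s' 2%N = x ^+ e].
apply: (@runs_while _ _ _ _ d.+1 I).
- by split; rewrite // d1 big_ord0.
- move=> e tau s1 ed fr [-> t9 t1 t2]; have [fi fd _ fn] := fr.
  have rs1 := regs_frame fr isT rs.
  split; first by rewrite /= t9 (fi 2%N isT) s2.
  apply: runs_block => _; split=> /=.
  + by lia.
  + by rewrite t9 (regs_1 rs1) addn1.
  + by rewrite t1 t2 t9 (regs_n rs1) (fn isT) cf // big_ord_recr.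
  + by rewrite t2 (fd 0%N isT) d0 exprSr.
move=> tau s1 fr [-> t9 t1 t2]; have [fi _ _ _] := fr.
split; first by rewrite /= t9 (fi 2%N isT) s2 ltnn.
by rewrite addn1.
Qed.

Lemma evaluation_loopP s :
  regs s -> ireg s 2 = d -> ireg s 7 = m.-1 -> ireg s 8 = 0%N ->
  (forall e, (e <= d)%N -> dmem s (n + e)%N = coef e) ->
  runs evaluation_loop s (fun tau s' =>
    [/\ (tau <= m * (7 * d + 16) + 1)%N,
        forall x, (x < B)%N -> dmem s' x = dmem s x &
        forall i, (i < m)%N -> dmem s' (B + i)%N = b i]).
Proof.
move=> rs s2 s7 s8 cf.
pose I i tau s' := [/\ (tau <= i * (7 * d + 16))%N, ireg s' 8 = i,
  forall x, (x < B)%N -> dmem s' x = dmem s x &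
  forall j, (j < i)%N -> dmem s' (B + j)%N = b j].
apply: (@runs_while _ _ _ _ m I); first by [].
  move=> i tau s1 im fr [tauI t8 low dn]; have [fi _ _ _] := fr.
  have rs1 := regs_frame fr isT rs.
  split; first by rewrite /= t8 (fi 7%N isT) s7; lia.
  apply: runs_seq; apply: runs_frame; apply: runs_block => fr2.
  set s3 := foldl _ _ _ in fr2 *; have [gi _ _ _] := fr2.
  have rs3 := regs_frame fr2 isT rs1.
  have s3_2 : ireg s3 2 = d by rewrite (gi 2%N isT) (fi 2%N isT).
  have s3_9 : ireg s3 9 = 0%N by [].
  have s3_8 : ireg s3 8 = i by rewrite (gi 8%N isT).
  have d0 : dreg s3 0%N = i%:R by rewrite /= t8.
  have d1 : dreg s3 1%N = 0 by rewrite /= subrr.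
  have d2 : dreg s3 2%N = 1 by rewrite /= (regs_1 rs1).
  have dm3 : dmem s3 = dmem s1 by [].
  have cf3 e : (e <= d)%N -> dmem s3 (n + e)%N = coef e.
    by move=> ed; rewrite dm3 low ?cf // /B; lia.
  move: s3 {fr2 gi} rs3 s3_2 s3_9 s3_8 d0 d1 d2 dm3 cf3.
  move=> s3 rs3 s3_2 s3_9 s3_8 d0 d1 d2 dm3 cf3.
  apply: runs_seq; apply: (runs_conseq (power_sum_loopP rs3 s3_2 s3_9 d0 d1 d2 cf3)).
  move=> t4 s4 fr4 [-> e1]; have [hi _ _ hn] := fr4.
  have rs4 := regs_frame fr4 isT rs3.
  apply: runs_block => _; split=> /=.
  - by lia.
  - by rewrite (hi 8%N isT) s3_8 (regs_1 rs4) addn1.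
  - move=> x xB; rewrite (hi 8%N isT) s3_8 (regs_B rs4) (hn isT) dm3 low //.
    by case: eqP => // ?; lia.
  move=> j; rewrite (hi 8%N isT) s3_8 (regs_B rs4) (hn isT) dm3 eqn_add2l.
  rewrite ltnS leq_eqVlt e1 -bE; case: eqP => [->//|_ /=]; exact: dn.
move=> tau s1 fr [tauI t8 low dn]; have [fi _ _ _] := fr.
split; first by rewrite /= t8 (fi 7%N isT) s7; lia.
by split=> //; lia.
Qed.

(** Starting every cell at its candidate with [i = 0] establishes soundness, which the later passes
    only have to preserve. *)
Lemma first_terms_loopP s :
  regs s -> data s -> ireg s 6 = n.-1 -> ireg s 8 = 0%N -> dreg s 1%N = b 0 ->
  runs first_terms_loop s (fun tau s' =>
    [/\ (tau <= 6 * n + 1)%N, data s' & sound s']).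
Proof.
move=> rs ds s6 s8 d1; have [da _] := ds.
pose I i tau s' := [/\ (tau <= 6 * i)%N, ireg s' 8 = i,
  forall x, (x < C)%N -> dmem s' x = dmem s x &
  forall j, (j < i)%N -> dmem s' (C + j)%N = a j + b 0].
apply: (@runs_while _ _ _ _ n I); first by [].
  move=> i tau s1 im fr [tauI t8 low dn]; have [fi fd _ _] := fr.
  have rs1 := regs_frame fr isT rs.
  split; first by rewrite /= t8 (fi 6%N isT) s6; lia.
  apply: runs_block => _; split=> /=.
  - by lia.
  - by rewrite t8 (regs_1 rs1) addn1.
  - move=> x xC; rewrite t8 (regs_C rs1).
    by case: eqP => [?|_]; [lia | apply: low].
  move=> j; rewrite t8 (regs_C rs1) eqn_add2l ltnS leq_eqVlt.
  case: eqP => [->_|_ /=]; last exact: dn.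
  by rewrite (fd 1%N isT) d1 low ?da // /C; lia.
move=> tau s1 fr [tauI t8 low dn]; have [fi _ _ _] := fr.
split; first by rewrite /= t8 (fi 6%N isT) s6; lia.
split; [lia | exact: (data_low nB BC low) | move=> k kn].
by exists 0%N => //; rewrite addn0; apply: dn.
Qed.

Lemma output_loopP s :
  regs s -> ireg s 6 = n.-1 -> ireg s 8 = 0%N ->
  runs output_loop s (fun tau s' =>
    (tau <= 5 * n + 1)%N /\
    forall k, (k < n)%N -> dmem s' k = dmem s (C + k)%N).
Proof.
move=> rs s6 s8.
pose I i tau s' := [/\ (tau <= 5 * i)%N, ireg s' 8 = i,
  forall x, (C <= x)%N -> dmem s' x = dmem s x &
  forall j, (j < i)%N -> dmem s' j = dmem s (C + j)%N].
apply: (@runs_while _ _ _ _ n I); first by [].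
  move=> i tau s1 im fr [tauI t8 low dn]; have [fi fd _ _] := fr.
  have rs1 := regs_frame fr isT rs.
  split; first by rewrite /= t8 (fi 6%N isT) s6; lia.
  apply: runs_block => _; split=> /=.
  - by lia.
  - by rewrite t8 (regs_1 rs1) addn1.
  (* Overwriting [a] leaves the results intact, since they are stored from [C >= n] on. *)
  - move=> x xC; rewrite t8; case: eqP => [?|_]; last exact: low.
    by have : (n <= C)%N; [rewrite /C /B|]; lia.
  move=> j; rewrite t8 (regs_C rs1) ltnS leq_eqVlt.
  case: eqP => [->_|_ /=]; last exact: dn.
  by rewrite low // leq_addr.
move=> tau s1 fr [tauI t8 low dn]; have [fi _ _ _] := fr.
split; first by rewrite /= t8 (fi 6%N isT) s6; lia.
by split=> //; lia.
Qed.

(** The two bounds on the offsets say, without subtraction, that [(D' - w', D' + w')] lies in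
    [(D - w, D + w)]. *)
Lemma good_sub w w' D D' :
  (w' <= w)%N -> (D' + w' <= D + w)%N -> (D + w' <= D' + w)%N ->
  good m b w D -> good m b w' D'.
Proof.
move=> h1 h2 h3 /and3P[h4 h5 cv]; apply/and3P; split; [lia|lia|].
have sub (P : pred nat) : all P (iota (D.+1 - w) (D + w - (D.+1 - w) - 2)) ->
    all P (iota (D'.+1 - w') (D' + w' - (D'.+1 - w') - 2)).
  move=> /allP hP; apply/allP => i; rewrite mem_iota => hi; apply: hP.
  by rewrite mem_iota; lia.
by case/orP: cv => /sub cv; apply/orP; [left|right].
Qed.

(* For the largest [p] whose square of side [2 ^ p] containing [(k, k + i)] is
   good, the square is processed: its parent is not good, hence neither is the
   fat range, which contains the range of the parent. *)
Lemma levels_cover s k i :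
  (forall p, (2 ^ p <= n)%N -> level_done n m C a b (2 ^ p) s) ->
  (k <= n - m)%N -> (i < m)%N ->
  dmem s (C + k)%N <= a (k + i)%N + b i.
Proof.
move=> lev kn im; set j := (k + i)%N.
pose D p := ((j %/ 2 ^ p - k %/ 2 ^ p) * 2 ^ p)%N.
(* Side 1 is good, as one value has no second difference; side [2 ^ m] is not, as it exceeds [m].
   The level sought precedes the first failure. *)
have [p gp ngp] : exists2 p, good m b (2 ^ p) (D p) & ~~ good m b (2 ^ p.+1) (D p.+1).
  have g0 : good m b (2 ^ 0) (D 0%N).
    rewrite /D /good expn0 !divn1 muln1 /j addKn addn1 im subSS subn0 /=.
    by rewrite /convex (_ : _ - 2 = 0)%N //; lia.
  have gm : ~~ good m b (2 ^ m) (D m).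
    by rewrite /good !negb_and -ltnNge; have := ltn_expl m (isT : (1 < 2)%N); lia.
  have exN : exists p, ~~ good m b (2 ^ p) (D p) by exists m.
  case: (ex_minnP exN) => -[|p] ng least; first by rewrite g0 in ng.
  by exists p => //; apply: contraT => /least; rewrite ltnn.
set L := (2 ^ p)%N in gp ngp *; have L0 : (0 < L)%N by rewrite expn_gt0.
have kj : (k %/ L <= j %/ L)%N by rewrite leq_div2r // leq_addr.
pose delta := (j %/ L - k %/ L)%N.
have DE : D p = (delta * L)%N by [].
(* The offset of the parent differs from [D p] by at most [L], so its range of half-width [2 * L]
   lies in the wide one of half-width [3 * L]. *)
have pr : processed m b L delta.
  rewrite /processed -DE gp /=; apply: contra ngp; apply: good_sub.
  - by rewrite expnS -/L; lia.
  - rewrite /D expnS -/L mulnC !(mulnC 2) !divnMA; nia.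
  - rewrite /D expnS -/L mulnC !(mulnC 2) !divnMA; nia.
have /and3P[h1 h2 _] := gp.
have ek := divn_eq k L; have ej := divn_eq j L.
have xL : (k %% L < L)%N by rewrite ltn_mod.
have yL : (j %% L < L)%N by rewrite ltn_mod.
have Ln : (L <= n)%N by lia.
have eD : (k %/ L * L + delta * L = j %/ L * L)%N.
  by rewrite -mulnDl subnKC.
(* The square fits: its columns end by [k + D p + L], which is at most [k + m <= n]. *)
have qN : (k %/ L < n %/ L - delta)%N.
  rewrite ltn_subRL -addnS leq_divRL //.
  have -> : ((delta + (k %/ L).+1) * L = k %/ L * L + delta * L + L)%N by lia.
  by rewrite DE in h2; lia.
have := lev p Ln delta pr (k %/ L)%N (k %% L)%N (j %% L)%N qN xL yL.
rewrite -ek eD -ej.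
suff -> : (delta * L + j %% L - k %% L = i)%N by [].
move: ek ej eD; rewrite {1}/j.
move: (k %/ L * L)%N (j %/ L * L)%N (delta * L)%N (k %% L)%N (j %% L)%N; lia.
Qed.

Lemma window_progP s E :
  [/\ ireg s 0 = n, ireg s 1 = m, ireg s 2 = d & dreg s 9 = 0] ->
  (forall j, (j < n)%N -> dmem s j = a j) ->
  (forall e, (e <= d)%N -> dmem s (n + e)%N = coef e) ->
  (forall p, \sum_(delta < n %/ 2 ^ p) processed m b (2 ^ p) delta <= E)%N ->
  runs window_prog s (fun tau s' =>
    (tau <= m * (7 * d + 16) + 11 * n + (trunc_log 2 n).+1 *
           (182 * n + E * (71 * (n * (trunc_log 2 n).+1))) + 15)%N /\
    forall k, (k <= n - m)%N -> dmem s' k = window_min a b m k).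
Proof.
move=> [s0 s1 s2 d9] da dc cnt.
apply: runs_seq; apply: runs_frame; apply: runs_block => fr1.
set t := foldl _ _ _ in fr1 *; have [gi _ _ _] := fr1.
have rt : regs t by split=> //; rewrite /= s0 ?s1 ?s2 // /C /B; lia.
have t2 : ireg t 2 = d by rewrite (gi 2%N isT).
have t6 : ireg t 6 = n.-1 by rewrite /= s0 subn1.
have t7 : ireg t 7 = m.-1 by rewrite /= s1 subn1.
have t8 : ireg t 8 = 0%N by [].
have tda : forall j, (j < n)%N -> dmem t j = a j by [].
have tdc : forall e, (e <= d)%N -> dmem t (n + e)%N = coef e by [].
move: t {fr1 gi} rt t2 t6 t7 t8 tda tdc => t rt t2 t6 t7 t8 tda tdc.
apply: runs_seq; apply: (runs_conseq (evaluation_loopP rt t2 t7 t8 tdc)).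
move=> tau1 u fr [tau1I low db]; have [gi _ _ _] := fr.
have ru := regs_frame fr isT rt.
have du : data u.
  by split=> // j jn; rewrite low ?tda // /B; lia.
have u6 : ireg u 6 = n.-1 by rewrite (gi 6%N isT).
apply: runs_seq; apply: runs_frame; apply: runs_block => fr2.
set v := foldl _ _ _ in fr2 *.
have rv := regs_frame fr2 isT ru; have dv : data v by [].
have v6 : ireg v 6 = n.-1 by [].
have v8 : ireg v 8 = 0%N by [].
have v1 : dreg v 1%N = b 0.
  by rewrite /= (regs_B ru) -[B]addn0 db.
move: v {fr2} rv dv v6 v8 v1 => v rv dv v6 v8 v1.
apply: runs_seq; apply: (runs_conseq (first_terms_loopP rv dv v6 v8 v1)).
move=> tau3 w fr3 [tau3I dw sw]; have [hi _ _ _] := fr3.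
have rw := regs_frame fr3 isT rv.
have n0 : (0 < n)%N by apply: leq_trans mn.
apply: runs_seq; apply: (runs_conseq (levels_progP nB BC n0 cnt rw dw)).
move=> tau4 x fr4 [tau4I [_ _ snd] lev]; have [ki _ _ _] := fr4.
have rx := regs_frame fr4 isT rw.
apply: runs_seq; apply: runs_frame; apply: runs_do => fr5.
set y := step _ _ in fr5 *.
have ry := regs_frame fr5 isT rx.
have y6 : ireg y 6 = n.-1 by rewrite /= (ki 6%N isT) (hi 6%N isT).
apply: (runs_conseq (output_loopP ry y6 (erefl : ireg y 8 = 0%N))).
move=> tau5 z _ [tau5I out]; split.
  by move: tau4I => /=; set X := (_ * (_ + _))%N; move: X => X; lia.
move=> k kn; rewrite out; last by lia.
(* Coverage of all candidates gives one inequality; soundness gives the other. *)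
rewrite /window_min big_mkord; apply/le_anti/andP; split.
  apply: le_bigmin => [|i _]; last exact: (levels_cover lev kn).
  by have := levels_cover lev kn m0; rewrite addn0.
have [i im ->] := snd sw k ltac:(lia).
exact: (bigmin_le (a k + b 0) (Ordinal im) (fun i : 'I_m => a (k + i)%N + b i)).
Qed.

End Window.

(** * Counting the processed offsets *)

(** One linear factor is split off per root; [pselect] decides whether a root exists. *)
Lemma poly_roots_seq (F : fieldType) (p : {poly F}) :
  p != 0 ->
  exists2 rs : seq F, (size rs < size p)%N & forall x, root p x -> x \in rs.
Proof.
have [k] := ubnP (size p); elim: k p => // k IHk p pk p0.
have [[x px]|nr] := pselect (exists x, root p x); last first.
  exists [::] => [|x px]; first by rewrite size_poly_gt0.
  by case: nr; exists x.
have /factor_theorem[q pq] := px.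
have q0 : q != 0 by apply: contraNneq p0 => q0; rewrite pq q0 mul0r.
have sp : size p = (size q).+1 by rewrite pq size_Mmonic ?monicXsubC // size_XsubC addn2.
have [|rs srs hrs] := IHk q _ q0; first by rewrite -ltnS -sp.
exists (x :: rs) => [|y]; first by rewrite sp ltnS.
rewrite pq rootM root_XsubC inE => /orP[/hrs->|->//].
by rewrite orbT.
Qed.

Definition near (L x delta : nat) : bool :=
  ((delta * L < x + 3 * L) && (x < delta * L + 3 * L))%N.

(** With [q] the block containing [x], only the offsets from [q - 2] to [q + 3] are possible. *)
Lemma count_near (M L x : nat) :
  (0 < L)%N -> (\sum_(delta < M) near L x delta <= 6)%N.
Proof.
move=> L0; set q := (x %/ L)%N.
have xq : (q * L <= x < q * L + L)%N.
  by rewrite leq_trunc_div /= addnC -mulSn ltn_ceil.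
rewrite -(big_mkord xpredT (fun delta => nat_of_bool (near L x delta))).
rewrite -big_mkcond sum1_count -size_filter -(size_iota (q - 2) 6).
apply: uniq_leq_size; first by rewrite filter_uniq ?iota_uniq.
move=> delta; rewrite mem_filter !mem_iota => /andP[/andP[h1 h2] _].
have h3 : (delta * L < (q + 4) * L)%N by lia.
have h4 : (q * L < (delta + 3) * L)%N by lia.
by move: h3 h4; rewrite !ltn_pmul2r // => h3 h4; lia.
Qed.

Section Count.
Variables (R : realType) (m d : nat) (f : {poly R}).
Hypothesis fd : (size f <= d.+1)%N.
Let b i := f.[i%:R].

(** The second difference as a polynomial over the reals, so that its sign changes become roots. *)
Let G : {poly R} := f \Po ('X + 2%:P) - (f \Po ('X + 1%:P)) *+ 2 + f.

Let GE (i : nat) : G.[i%:R] = b i.+2 - b i.+1 *+ 2 + b i.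
Proof.
have e2 : i.+2%:R = i%:R + 2 :> R by rewrite -natrD addn2.
have e1 : i.+1%:R = i%:R + 1 :> R by rewrite -addn1 natrD.
by rewrite /G /b e2 e1 !(hornerD, hornerN, hornerMn) !horner_comp !hornerE.
Qed.

Let size_G : (size G <= d.+1)%N.
Proof.
have sz c : (size (f \Po ('X + c%:P)) <= d.+1)%N.
  by rewrite size_comp_poly2 // size_XaddC.
rewrite (leq_trans (size_polyD _ _)) // geq_max fd andbT.
rewrite (leq_trans (size_polyD _ _)) // geq_max sz size_polyN.
by rewrite mulr2n (leq_trans (size_polyD _ _)) // geq_max sz.
Qed.

(** Failure of both properties yields a negative and a positive value of [G]; the intermediate value
    theorem gives a root between them. *)
Lemma curvature_root lo hi :
  ~~ convex b lo hi -> ~~ concave b lo hi ->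
  G != 0 /\ exists2 x, root G x & lo%:R <= x < hi%:R.
Proof.
move=> /allPn[i]; rewrite mem_iota -ltNge => hi1 cv1 /allPn[j].
rewrite mem_iota -ltNge => hj1 cv2.
have Gi : G.[i%:R] < 0 by rewrite GE; lra.
have Gj : 0 < G.[j%:R] by rewrite GE; lra.
split; first by apply: contraTneq Gj => ->; rewrite horner0 ltxx.
have sub (x : R) (k l : nat) : (lo <= k)%N -> (l < hi)%N -> k%:R <= x <= l%:R ->
      lo%:R <= x < hi%:R.
  move=> lk lh /andP[kx xl]; rewrite (le_trans _ kx) ?ler_nat //=.
  by rewrite (le_lt_trans xl) // ltr_nat.
have [ij|ji] := leP (i%:R : R) j%:R.
  have [|x xij rx] := @poly_ivt _ G i%:R j%:R ij; first by rewrite !ltW.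
  by exists x => //; apply: (sub x i j) xij; lia.
have [|x xij] := @poly_ivt _ (- G) j%:R i%:R (ltW ji).
  by rewrite !hornerN oppr_ge0 oppr_le0 !ltW.
by rewrite rootN => rx; exists x => //; apply: (sub x j i) xij; lia.
Qed.

Lemma processed_near :
  exists2 xs : seq nat, (size xs <= d.+2)%N & forall L delta, (0 < L)%N ->
    processed m b L delta ->
    has (near L ^~ delta) xs.
Proof.
(* If [G] vanishes the list is empty, which is harmless because [curvature_root] provides
   [G != 0]. *)
have [rs srs hrs] : exists2 rs : seq R, (size rs <= d)%N &
    G != 0 -> forall x, root G x -> x \in rs.
  have [G0|G0] := eqVneq G 0; first by exists [::].
  have [rs srs hrs] := poly_roots_seq G0; exists rs => //.
  by rewrite -ltnS (leq_trans srs).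
(* The wide range fails by passing below 0, by passing beyond [m], or by containing a root of [G];
   each listed point accounts for one such cause. *)
exists [:: 0%N, m & map Num.truncn rs]; first by rewrite /= size_map.
move=> L delta L0 /andP[/and3P[h1 h2 _]].
rewrite /good !negb_and negb_or /= => /or3P[h|h|/andP[h3 h4]].
- by apply/orP; left; rewrite /near; lia.
- by apply/orP; right; apply/orP; left; rewrite /near; lia.
apply/orP; right; apply/orP; right.
have [G0 [x rx /andP[lx xh]]] := curvature_root h3 h4.
rewrite has_map; apply/hasP; exists x; first exact: hrs.
have x0 : 0 <= x by rewrite (le_trans _ lx).
have /andP[tx xt] := truncn_itv x0.
have := le_lt_trans tx xh; have := le_lt_trans lx xt; rewrite !ltr_nat /= /near; lia.
Qed.

(** Double counting: every processed offset is near one of [d.+2] points, and each point is near at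
    most 6 offsets. *)
Lemma processed_count (M L : nat) : (0 < L)%N ->
  (\sum_(delta < M) processed m b L delta <= 6 * d.+2)%N.
Proof.
move=> L0; have [xs sxs hxs] := processed_near.
apply: (@leq_trans (\sum_(delta < M) \sum_(x <- xs) near L x delta)%N).
  apply: leq_sum => delta _; case pr: (processed _ _ _ _) => //=.
  have /hasP[x xin hx] := hxs L delta L0 pr.
  by rewrite (big_rem x) //= hx.
rewrite exchange_big /=.
apply: (@leq_trans (\sum_(x <- xs) 6)%N).
  by apply: leq_sum => x _; apply: count_near.
by rewrite big_const_seq count_predT iter_addn_0 leq_mul2l sxs.
Qed.

End Count.

(** * The bound *)

Section Bounds.
Variable R : realType.

Lemma ln2_gt0 : 0 < ln 2 :> R.
Proof. by apply: ln_gt0; rewrite ltr1n. Qed.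

Lemma log2_ge0 (x : R) : 1 <= x -> 0 <= log2 x.
Proof. by move=> x1; rewrite divr_ge0 ?ln_ge0 ?ler1n. Qed.

Lemma trunc_log2_le (n : nat) : (0 < n)%N -> (trunc_log 2 n)%:R <= log2 n%:R :> R.
Proof.
move=> n0; rewrite ler_pdivlMr ?ln2_gt0 // mulr_natl -lnXn ?ltr0n //.
by rewrite ler_ln ?posrE ?exprn_gt0 ?ltr0n // -natrX ler_nat trunc_logP.
Qed.

Lemma log2_ge1 (n : nat) : (1 < n)%N -> 1 <= log2 n%:R :> R.
Proof.
move=> n1; rewrite ler_pdivlMr ?ln2_gt0 // mul1r.
by rewrite ler_ln ?posrE ?ltr0n ?ler_nat // ltnW.
Qed.

(** For [x >= 0], multiplying [x + 1 / (1 + x) >= 1] by [1 + x] leaves [x ^ 2 >= 0]. *)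
Lemma sigma_ge1 (d : nat) : (0 < d)%N -> 1 <= sigma R d.
Proof.
move=> d0; rewrite /sigma; have : 0 <= log2 d%:R :> R by rewrite log2_ge0 ?ler1n.
move: (log2 _) => x x0; have x1 : 0 < 1 + x by lra.
rewrite -(ler_pM2r x1) mulrDl divfK ?gt_eqF //; nra.
Qed.

(** The exponent is at least 1, so a bound linear in [n] implies the claimed one. *)
Lemma le_powR_sigma (n d : nat) : (0 < n)%N -> (0 < d)%N ->
  n%:R <= powR n%:R (1 + (sigma R d - 1) / sigma R d).
Proof.
move=> n0 d0; have s1 := sigma_ge1 d0; apply: le1r_powR; first by rewrite ler1n.
by rewrite lerDl divr_ge0 //; lra.
Qed.

End Bounds.

(** Each summand is a multiple of [d * n * l.+1 ^ 2], with factors 23, 11, 182, 1278 = 3 * 426 and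
    15, whose sum is below 1550. *)
Lemma time_bound (t n m d l : nat) :
  (0 < d)%N -> (0 < m <= n)%N ->
  (t <= m * (7 * d + 16) + 11 * n +
     l.+1 * (182 * n + 6 * d.+2 * (71 * (n * l.+1))) + 15)%N ->
  (t <= 1550 * (d * n * l.+1 ^ 2))%N.
Proof.
move=> d0 /andP[m0 mn] /leq_trans; apply.
have X1 : (m * (7 * d + 16) <= 23 * (d * n))%N by nia.
have X2 : (n <= d * n)%N by nia.
have X3 : (1 <= d * n)%N by nia.
have X4 : (d.+2 * n <= 3 * (d * n))%N by nia.
have -> : (6 * d.+2 * (71 * (n * l.+1)) = 426 * (d.+2 * n) * l.+1)%N by lia.
move: X1 X2 X3 X4; rewrite expnS expn1.
move: (m * _)%N (d.+2 * n)%N (d * n)%N => x y z X1 X2 X3 X4.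
have yk : (426 * y * l.+1 <= 1278 * z * l.+1)%N by rewrite leq_mul2r; lia.
have zk : (z <= z * l.+1)%N by rewrite leq_pmulr.
have zkk : (z * l.+1 <= z * l.+1 * l.+1)%N by rewrite leq_pmulr.
have : (l.+1 * (182 * n + 426 * y * l.+1) <=
        l.+1 * (182 * z + 1278 * z * l.+1))%N by rewrite leq_mul2l; lia.
by move: zk zkk; rewrite -mulnA; move: (l.+1 * (182 * n + _))%N; lia.
Qed.

Theorem theorem2 (R : realType) :
  exists (P : cmd) (C : R), 0 < C /\
    forall (d n m : nat) (a : n.-tuple R) (f : {poly int}),
      (0 < d)%N -> (0 < m <= n)%N -> (size f <= d.+1)%N ->
      exists (t : nat) (s : state R),
        [/\ exec P (init_state m d a f) t s,
            forall k : nat, (k <= n - m)%N ->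
              dmem s k
                = window_min (fun i => a`_i) (fun i => (f.[i%:Z])%:~R) m k &
            (1 < n)%N ->
              t%:R <= C * (d%:R ^+ 3
                           * n%:R `^ (1 + (sigma R d - 1) / sigma R d)
                           * log2 n%:R ^+ 2)].
Proof.
(* 6200 is 1550 times 4; the 4 comes from squaring [l.+1 <= 2 * log2 n], which holds because
   [log2 n >= 1] for [n > 1]. *)
exists window_prog, 6200; split=> // d n m a f d0 mn fd.
have [m0 mn'] := andP mn.
pose g : {poly R} := map_poly intr f.
have bE i : (f.[i%:Z])%:~R = g.[i%:R] :> R by rewrite -horner_map.
have gd : (size g <= d.+1)%N by rewrite (leq_trans (size_poly _ _)).
have sumE i : (f.[i%:Z])%:~R = \sum_(e < d.+1) (f`_e)%:~R * i%:R ^+ e :> R.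
  rewrite bE (horner_coef_wide _ gd).
  by apply: eq_bigr => e _; rewrite coef_map.
pose s0 : state R := init_state m d a f.
have ra j : (j < n)%N -> dmem s0 j = a`_j.
  by move=> jn; rewrite /= nth_cat size_tuple jn.
have rc e : (e <= d)%N -> dmem s0 (n + e)%N = (f`_e)%:~R.
  move=> ed; rewrite /s0 /init_state /dmem nth_cat size_tuple ltnNge leq_addr addKn.
  by rewrite (nth_map 0%N) ?size_iota // nth_iota.
have cnt p : (\sum_(delta < n %/ 2 ^ p)
    processed m (fun i => (f.[i%:Z])%:~R : R) (2 ^ p) delta <= 6 * d.+2)%N.
  rewrite (_ : (fun i : nat => _) = (fun i => g.[i%:R])); last exact/funext.
  by apply: processed_count => //; rewrite expn_gt0.
have r0 : [/\ ireg s0 0 = n, ireg s0 1 = m, ireg s0 2 = d & dreg s0 9 = 0] by [].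
have [t [s [ex [tI out]]]] := window_progP m0 mn' sumE r0 ra rc cnt.
exists t, s; split=> // n1; have n0 : (0 < n)%N by exact: ltnW.
have tI' := time_bound d0 mn tI.
have lg := trunc_log2_le R n0; have l1 := log2_ge1 R n1.
move: (trunc_log 2 n) tI' lg => l tI' lg.
have dd : d%:R <= d%:R ^+ 3 :> R.
  by rewrite -natrX ler_nat -{1}[d]expn1 leq_pexp2l.
have np := le_powR_sigma R n0 d0.
have ll : l.+1%:R ^+ 2 <= 4 * log2 n%:R ^+ 2 :> R.
  have : l.+1%:R <= 2 * log2 n%:R :> R by rewrite -addn1 natrD; lra.
  by move=> h; have : 0 <= l.+1%:R :> R by []; nra.
have -> : 6200 = 1550 * 4 :> R by lra.
apply: (@le_trans _ _ (1550 * (d%:R * n%:R * l.+1%:R ^+ 2))).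
  by rewrite -natrX -!natrM ler_nat.
rewrite -[leRHS]mulrA ler_pM2l // [leRHS]mulrCA.
by apply: ler_pM => //; rewrite ?mulr_ge0 ?exprn_ge0 //; apply: ler_pM.
Qed.
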